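(* Let $\mathcal{H}^A,\mathcal{H}^{A'},\mathcal{H}^B,\mathcal{H}^{B'}$ be qubit spaces, let $\mathcal{N}^{A\to B}$ be a quantum channel with Choi state $J_{\mathcal{N}}$, let $\{\Pi^{BB'}_j\}_{j\in\mathcal{X}}$, $\mathcal{X}=\{0,1,2,3\}$, be an arbitrary (uncharacterized) POVM on $\mathcal{H}^B\otimes\mathcal{H}^{B'}$, and let $a\in\mathcal{X}$ be the outcome announced as successful in the MDI-QKD protocol. Put $$\tilde\rho_j=4\,\mathrm{tr}_{AB}\left[\left(\Phi_+^{AA'}\otimes\Pi_j^{BB'}\right)\left(I^{A'}\otimes J_{\mathcal{N}}^{AB}\otimes I^{B'}\right)\right],\qquad j\in\mathcal{X},$$ and let $p(a|\,|\psi\rangle,|\phi\rangle)=\mathrm{tr}[\Pi_a^{BB'}(\mathcal{N}(|\psi\rangle\langle\psi|)\otimes|\phi\rangle\langle\phi|)]$ be the probability of the successful outcome when Alice inputs $|\psi\rangle$ and Bob inputs $|\phi\rangle$. Then the maximal distillable key rate $K$ satisfies $$\begin{aligned}K(J_{\mathcal{N}})&\ge\frac14\sum_{j\in\mathcal{X}}K(\tilde\rho_j)\ge\frac14K(\tilde\rho_a^T)\\&=\frac14K_a\big(p(a|\,|0\rangle,|0\rangle)+p(a|\,|0\rangle,|1\rangle)+p(a|\,|1\rangle,|0\rangle)+p(a|\,|1\rangle,|1\rangle)\big)\\&=\frac14K_a\big(p(a|\,|+\rangle,|+\rangle)+p(a|\,|+\rangle,|-\rangle)+p(a|\,|-\rangle,|+\rangle)+p(a|\,|-\rangle,|-\rangle)\big),\end{aligned}$$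 where $K_a$ is the maximal distillable key rate of the (normalized) state shared by Alice and Bob conditioned on the successful outcome $a$.
   Context: $\Phi_+^{AA'}=\frac12\sum_{j,k\in\{0,1\}}|jj\rangle\langle kk|$ is the maximally entangled two-qubit state, $J_{\mathcal{N}}=(id^{A'}\otimes\mathcal{N}^{A\to B})(\Phi_+^{AA'})$ is the Choi state, regarded as a state on $\mathcal{H}^A\otimes\mathcal{H}^B$, $|\pm\rangle=(|0\rangle\pm|1\rangle)/\sqrt2$, and $T$ is transposition in the computational product basis. MDI-QKD protocol (qubit, one-channel version). Alice and Bob independently and randomly prepare one of $|0\rangle,|1\rangle,|+\rangle,|-\rangle$; Alice sends her qubit to Bob through $\mathcal{N}^{A\to B}$; Bob performs the uncharacterized joint POVM $\{\Pi_j^{BB'}\}_{j\in\mathcal{X}}$ on the received qubit and his own qubit $B'$, and publicly announces success when the outcome is $a$; they keep only the successful data and distil a key. In the equivalent entanglement-based picture, conditioned on success they share the unnormalized state $\tilde\rho_a^T$ on $A'B'$. $K(\sigma)$ is the maximal distillable secret key rate of a bipartite state $\sigma^{AB}$: the supremum of asymptotic rates (per copy) at which Alice and Bob, holding many copies of $\sigma$ while an eavesdropper holds their purification, can obtain, by local operations and public classical communication (which the eavesdropper also receives), perfectly correlated uniform bits unknown to the eavesdropper, with error vanishing asymptotically. It is extended to unnormalized states by $K(\tilde\sigma):=\mathrm{tr}(\tilde\sigma)K(\tilde\sigma/\mathrm{tr}\,\tilde\sigma)$ and $K(0):=0$. $K_a:=K(\tilde\rho_a^T/\mathrm{tr}\,\tilde\rho_a)$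 when $\tilde\rho_a\ne0$ (when $\tilde\rho_a=0$ all the success probabilities vanish and the right-hand sides are $0$). *)

(* Defs.v *)
(* The scalars are the complex numbers R[i] over R : realType. *)
From HB Require Import structures.
From mathcomp Require Import all_boot all_order all_algebra.
From mathcomp Require Import spectral complex.
From mathcomp Require Import all_classical all_reals all_analysis.

Set Implicit Arguments.
Unset Strict Implicit.
Unset Printing Implicit Defensive.

Import Order.TTheory GRing.Theory Num.Theory.
Import numFieldNormedType.Exports.

Local Open Scope classical_set_scope.
Local Open Scope sesquilinear_scope.
Local Open Scope ring_scope.

(* A finite-dimensional system is a finite type T, the labels of its
   computational basis; its Hilbert space is C^T, realised on 'cV_#|T| through
   the enumeration of T.  The system composed of S and T is S * T, and n copies
   of T are {ffun 'I_n -> T}. *)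
Notation op R T := ('M[R[i]]_#|{: T}|).
Notation vec R T := ('cV[R[i]]_#|{: T}|).

Section Operators.
Variable R : realType.

Definition ent (T : finType) (X : op R T) (x y : T) : R[i] :=
  X (enum_rank x) (enum_rank y).

Definition mkop (T : finType) (f : T -> T -> R[i]) : op R T :=
  \matrix_(i, j) f (enum_val i) (enum_val j).

Definition ket (T : finType) (x : T) : vec R T := delta_mx (enum_rank x) 0.

Definition proj (T : finType) (v : vec R T) : op R T := v *m v ^t*.

(* For a bijection f, the same operator after the relabelling f of the basis;
   only used to reorder tensor factors. *)
Definition reindex (S T : finType) (f : S -> T) (X : op R T) : op R S :=
  mkop (fun x y => ent X (f x) (f y)).

Definition tens (S T : finType) (X : op R S) (Y : op R T) :
    op R (S * T) :=
  mkop (fun x y => ent X x.1 y.1 * ent Y x.2 y.2).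

Definition ptrace1 (S T : finType) (X : op R (S * T)) : op R T :=
  mkop (fun x y => \sum_(s : S) ent X (s, x) (s, y)).

Definition ptrace2 (S T : finType) (X : op R (S * T)) : op R S :=
  mkop (fun x y => \sum_(t : T) ent X (x, t) (y, t)).

(* Over C, nonnegativity of the quadratic form forces X to be Hermitian. *)
Definition psd (T : finType) (X : op R T) : Prop :=
  forall v : vec R T, 0 <= (v ^t* *m X *m v) 0 0.

(* tr sqrt(X^* X) *)
Definition trace_norm (T : finType) (X : op R T) : R :=
  complex.Re (\sum_i sqrtC (spectral_diag (X ^t* *m X) 0 i)).

(* id_T (x) F, computed block by block. *)
Definition idtens (T A B : finType) (F : op R A -> op R B)
    (X : op R (T * A)) : op R (T * B) :=
  mkop (fun x y =>
    ent (F (mkop (fun a a' => ent X (x.1, a) (y.1, a')))) x.2 y.2).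

Definition completely_positive (A B : finType) (F : op R A -> op R B) : Prop :=
  forall (T : finType) (X : op R (T * A)), psd X -> psd (idtens F X).

Definition is_channel (A B : finType) (F : {linear op R A -> op R B}) : Prop :=
  completely_positive F /\ forall X, \tr (F X) = \tr X.

Definition is_povm (T X : finType) (Pi : X -> op R T) : Prop :=
  (forall j, psd (Pi j)) /\ \sum_j Pi j = 1%:M.

(* Quantum instruments with outcomes in M. *)
Record instrument (A A' M : finType) := Instrument {
  branch :> M -> {linear op R A -> op R A'};
  branch_cp : forall m, completely_positive (branch m);
  branch_tp : forall X, \sum_m \tr (branch m X) = \tr X }.

Definition onA (A A' B E : finType) (F : op R A -> op R A')
    (X : op R (A * B * E)) : op R (A' * B * E) :=
  reindex (fun x : A' * B * E => ((x.1.2, x.2), x.1.1))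
    (idtens F (reindex (fun x : (B * E) * A => (x.2, x.1.1, x.1.2)) X)).

Definition onB (A B B' E : finType) (F : op R B -> op R B')
    (X : op R (A * B * E)) : op R (A * B' * E) :=
  reindex (fun x : A * B' * E => ((x.1.1, x.2), x.1.2))
    (idtens F (reindex (fun x : (A * E) * B => (x.1.1, x.2, x.1.2)) X)).

(* Two-way LOPC protocols taking the systems A of Alice and B of Bob to KA and
   KB.  In each round one party applies an instrument to her/his system and
   broadcasts the outcome, on which the rest of the protocol may depend.
   Private outcomes, memory and randomness are part of the local systems. *)
Inductive lopc (KA KB : finType) : finType -> finType -> Type :=
| Done : lopc KA KB KA KB
| AliceTalks (A A' B M : finType) of
    instrument A A' M & (M -> lopc KA KB A' B) : lopc KA KB A B
| BobTalks (A B B' M : finType) of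
    instrument B B' M & (M -> lopc KA KB A B') : lopc KA KB A B.

Fixpoint transcript (KA KB A B : finType) (P : lopc KA KB A B) : finType :=
  match P with
  | Done => unit
  | AliceTalks _ _ _ M _ next => {m : M & transcript (next m)}
  | BobTalks _ _ _ M _ next => {m : M & transcript (next m)}
  end.

(* The unnormalised state of KA, KB, E when the public transcript is t; its
   trace is the probability of t. *)
Fixpoint run (E KA KB A B : finType) (P : lopc KA KB A B) {struct P} :
    op R (A * B * E) -> transcript P -> op R (KA * KB * E) :=
  match P in lopc _ _ A B
    return op R (A * B * E) -> transcript P -> op R (KA * KB * E) with
  | Done => fun X _ => X
  | AliceTalks _ _ _ _ F next =>
      fun X t => run (onA (F (tag t)) X) (tagged t)
  | BobTalks _ _ _ _ F next =>
      fun X t => run (onB (F (tag t)) X) (tagged t)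
  end.

(* The joint final state: the eavesdropper holds E and a classical register
   containing the whole public communication. *)
Definition final_state (E KA KB A B : finType) (P : lopc KA KB A B)
    (X : op R (A * B * E)) :
    op R ((KA * KB) * (E * transcript P)) :=
  mkop (fun x y => if x.2.2 == y.2.2
    then ent (run X x.2.2) (x.1, x.2.1) (y.1, y.2.1) else 0).

Definition key (l : nat) : finType := l.-tuple bool.

(* Two perfectly correlated, uniformly distributed strings of l bits. *)
Definition ideal_key (l : nat) : op R (key l * key l) :=
  (2 ^+ l)^-1 *: \sum_(k : key l) proj (ket (k, k)).

(* Trace distance from the final state to an ideal key that is uncorrelated
   with the eavesdropper. *)
Definition key_error (l : nat) (E A B : finType)
    (P : lopc (key l) (key l) A B) (X : op R (A * B * E)) : R :=
  2^-1 * trace_norm (final_state P X - tens (ideal_key l) (ptrace1 (final_state P X))).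

Definition purifies (A B E : finType) (psi : vec R (A * B * E))
    (sigma : op R (A * B)) : Prop :=
  ptrace2 (proj psi) = sigma.

Definition copies (n : nat) (A B E : finType) (X : op R (A * B * E)) :
    op R ({ffun 'I_n -> A} * {ffun 'I_n -> B} * {ffun 'I_n -> E}) :=
  mkop (fun x y : {ffun 'I_n -> A} * {ffun 'I_n -> B} * {ffun 'I_n -> E} =>
    \prod_(i < n)
    ent X (x.1.1 i, x.1.2 i, x.2 i) (y.1.1 i, y.1.2 i, y.2 i)).

(* The protocols do not depend on the purification held by the eavesdropper. *)
Definition achievable (A B : finType) (sigma : op R (A * B)) (r : R) :
    Prop :=
  exists (l : nat -> nat)
    (P : forall n, lopc (key (l n)) (key (l n)) {ffun 'I_n -> A} {ffun 'I_n -> B}),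
    (fun n => (l n)%:R / n%:R : R) @ \oo --> r /\
    forall (E : finType) (psi : vec R (A * B * E)), purifies psi sigma ->
      (fun n => key_error (P n) (copies n (proj psi))) @ \oo --> (0 : R).

(* The supremum is taken in the extended reals, so that it is the actual
   supremum without any a priori bound on the achievable rates. *)
Definition distillable_key (A B : finType) (sigma : op R (A * B)) : \bar R :=
  ereal_sup (EFin @` [set r | achievable sigma r]).

(* The extension of the distillable key rate to unnormalised states. *)
Definition K (A B : finType) (sigma : op R (A * B)) : \bar R :=
  if sigma == 0 then 0%E
  else ((complex.Re (\tr sigma))%:E *
        distillable_key ((\tr sigma)^-1 *: sigma))%E.

Definition qubit : finType := 'I_2.

Definition ket0 : vec R qubit := ket (0 : 'I_2).
Definition ket1 : vec R qubit := ket (1 : 'I_2).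
Definition ketp : vec R qubit := (sqrtC 2)^-1 *: (ket0 + ket1).
Definition ketm : vec R qubit := (sqrtC 2)^-1 *: (ket0 - ket1).

Definition Phi_plus : op R (qubit * qubit) :=
  2^-1 *: \sum_(j : qubit) \sum_(k : qubit) (ket (j, j) *m (ket (k, k)) ^t*).

Definition choi (N : op R qubit -> op R qubit) : op R (qubit * qubit) :=
  idtens N Phi_plus.

(* 4 tr_AB[(Phi_+^AA' (x) Pi^BB') (I^A' (x) J^AB (x) I^B')], an operator on
   A'B'.  The product is formed with the factors in the order (A A')(B B'). *)
Definition rho_tilde (J Pi : op R (qubit * qubit)) :
    op R (qubit * qubit) :=
  let IJI : op R ((qubit * qubit) * (qubit * qubit)) :=
    reindex (fun x : (qubit * qubit) * (qubit * qubit) =>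
               ((x.1.2, (x.1.1, x.2.1)), x.2.2))
      (tens (tens (1%:M : op R qubit) J) (1%:M : op R qubit)) in
  4 *: ptrace2
    (reindex (fun x : (qubit * qubit) * (qubit * qubit) =>
                ((x.2.1, x.1.1), (x.2.2, x.1.2)))
       (tens Phi_plus Pi *m IJI)).

(* tr[Pi (N(|psi><psi|) (x) |phi><phi|)] *)
Definition prob (N : op R qubit -> op R qubit) (Pi : op R (qubit * qubit))
    (psi phi : vec R qubit) : R :=
  complex.Re (\tr (Pi *m tens (N (proj psi)) (proj phi))).

End Operators.

(* Main.v *)
(** Let f_j be the map by which Bob prepares a Bell pair B'B'', obtains the
    outcome j of the POVM on BB'' and keeps B'; then
    rho_j^T / 4 = (id (x) f_j)(J).  From n copies of J, Bob measures all of them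
    and announces the outcomes; if every j with p_j := tr rho_j / 4 > 0 occurs at
    least m_j = floor(lam p_j n) times, lam < 1, they run an optimal protocol for
    outcome j on m_j of the copies with that outcome, one j after the other, and
    concatenate the keys.  The errors add up, and Chebyshev's inequality disposes
    of the other announcements, so every lam * sum_j p_j r_j with r_j achievable
    for outcome j is achievable for J.  The measurement leaves mixed states, which
    are partial traces, on the eavesdropper's side, of purifications; this can only
    decrease the error.  Conjugating a protocol entrywise shows that K(rho) =
    K(rho^T), and the remaining equalities express tr rho_a through the
    resolutions of identity given by the two bases. *)
Require Import Defs.
From HB Require Import structures.
From mathcomp Require Import all_boot all_order all_algebra.
From mathcomp Require Import spectral complex.
From mathcomp Require Import all_classical all_reals all_analysis.
From mathcomp Require Import ring lra.

Set Implicit Arguments.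
Unset Strict Implicit.
Unset Printing Implicit Defensive.

Import Order.TTheory GRing.Theory Num.Theory.
Import numFieldNormedType.Exports.
Import Defs.

Local Open Scope sesquilinear_scope.
Local Open Scope ring_scope.

(** * Operators in the computational basis *)

Section Entries.
Variable R : realType.
Local Notation C := R[i].

(** The transcripts of composed protocols have different dependent types, so protocols are compared
    only through sums, over their transcripts, of a function of the final state; composition then
    becomes nesting of sums. Copies that wait while others are processed are counted as part of the
    eavesdropper's system: local instruments commute with the linear maps used on that system, and
    the bounds hold for every eavesdropper. The factor lam < 1 leaves a gap of at least n p_j (1 -
    lam) between the expected count and m_j, hence a failure probability of order 1/n. A protocol
    has one fixed key length, so even after a bad announcement it must output keys of that length;
    the error there is at most twice the probability. As a protocol may not depend on the
    purification, every construction is made before the eavesdropper is introduced. Rates are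
    suprema in the extended reals: when K(J) is finite, finiteness of the supremum for each outcome
    of nonzero probability is itself extracted from the achievability bound. *)

Lemma ent_mkop (T : finType) (f : T -> T -> C) x y : ent (mkop f) x y = f x y.
Proof. by rewrite /ent /mkop mxE !enum_rankK. Qed.

Lemma opP (T : finType) (X Y : op R T) : ent X =2 ent Y -> X = Y.
Proof.
move=> XY; apply/matrixP => i j.
by rewrite -(enum_valK i) -(enum_valK j); apply: XY.
Qed.

Lemma mkop_ext (T : finType) (f g : T -> T -> C) : f =2 g -> mkop f = mkop g.
Proof. by move=> fg; apply: opP => x y; rewrite !ent_mkop. Qed.

Lemma sum_enum_rank (V : nmodType) (T : finType) (F : 'I_#|{: T}| -> V) :
  \sum_i F i = \sum_(x : T) F (enum_rank x).
Proof. by rewrite (bigop.reindex _ (onW_bij _ (@enum_rank_bij T))). Qed.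

Lemma sum_pair (V : nmodType) (S T : finType) (F : S * T -> V) :
  \sum_x F x = \sum_s \sum_t F (s, t).
Proof. by rewrite pair_bigA; apply: eq_bigr => -[]. Qed.

Lemma ent_add (T : finType) (X Y : op R T) x y : ent (X + Y) x y = ent X x y + ent Y x y.
Proof. by rewrite /ent mxE. Qed.

Lemma ent_opp (T : finType) (X : op R T) x y : ent (- X) x y = - ent X x y.
Proof. by rewrite /ent mxE. Qed.

Lemma ent_scale (T : finType) c (X : op R T) x y : ent (c *: X) x y = c * ent X x y.
Proof. by rewrite /ent mxE. Qed.

Lemma ent1 (T : finType) x y : ent (1%:M : op R T) x y = (x == y)%:R.
Proof. by rewrite /ent mxE (inj_eq enum_rank_inj). Qed.

Lemma ent_sum (T I : finType) (P : pred I) (X : I -> op R T) x y :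
  ent (\sum_(i | P i) X i) x y = \sum_(i | P i) ent (X i) x y.
Proof. by rewrite /ent summxE. Qed.

Lemma ent_mul (T : finType) (X Y : op R T) x y :
  ent (X *m Y) x y = \sum_z ent X x z * ent Y z y.
Proof. by rewrite /ent mxE sum_enum_rank. Qed.

Lemma ent_tr (T : finType) (X : op R T) x y : ent X^T x y = ent X y x.
Proof. by rewrite /ent mxE. Qed.

Lemma ent_trC (T : finType) (X : op R T) x y : ent (X ^t*) x y = (ent X y x)^*%R.
Proof. by rewrite /ent !mxE. Qed.

Lemma ent_outer (T : finType) (v w : vec R T) x y :
  ent (v *m w ^t*) x y = v (enum_rank x) 0 * (w (enum_rank y) 0)^*%R.
Proof. by rewrite /ent mxE big_ord1 !mxE. Qed.

Lemma ent_proj (T : finType) (v : vec R T) x y :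
  ent (proj v) x y = v (enum_rank x) 0 * (v (enum_rank y) 0)^*%R.
Proof. exact: ent_outer. Qed.

Lemma ketE (T : finType) (x y : T) : ket R x (enum_rank y) 0 = (y == x)%:R.
Proof. by rewrite /ket mxE (inj_eq enum_rank_inj) eqxx andbT. Qed.

Lemma ent_reindex (S T : finType) (f : S -> T) (X : op R T) x y :
  ent (reindex f X) x y = ent X (f x) (f y).
Proof. exact: ent_mkop. Qed.

Lemma ent_tens (S T : finType) (X : op R S) (Y : op R T) x y :
  ent (tens X Y) x y = ent X x.1 y.1 * ent Y x.2 y.2.
Proof. exact: ent_mkop. Qed.

Lemma ent_ptrace1 (S T : finType) (X : op R (S * T)) x y :
  ent (ptrace1 X) x y = \sum_s ent X (s, x) (s, y).
Proof. exact: ent_mkop. Qed.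

Lemma ent_ptrace2 (S T : finType) (X : op R (S * T)) x y :
  ent (ptrace2 X) x y = \sum_s ent X (x, s) (y, s).
Proof. exact: ent_mkop. Qed.

Lemma ent_idtens (T A B : finType) (F : op R A -> op R B) (X : op R (T * A)) x y :
  ent (idtens F X) x y =
  ent (F (mkop (fun a a' => ent X (x.1, a) (y.1, a')))) x.2 y.2.
Proof. exact: ent_mkop. Qed.

Definition slice_onA (A B E : finType) (X : op R (A * B * E)) (b b' : B) (e e' : E) :
  op R A := mkop (fun a a' => ent X (a, b, e) (a', b', e')).

Definition slice_onB (A B E : finType) (X : op R (A * B * E)) (a a' : A) (e e' : E) :
  op R B := mkop (fun b b' => ent X (a, b, e) (a', b', e')).

Lemma ent_onA (A A' B E : finType) (F : op R A -> op R A') (X : op R (A * B * E)) x y :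
  ent (onA F X) x y = ent (F (slice_onA X x.1.2 y.1.2 x.2 y.2)) x.1.1 y.1.1.
Proof.
rewrite /onA ent_reindex ent_idtens /=; congr (ent (F _) _ _).
by apply: mkop_ext => a a'; rewrite ent_reindex.
Qed.

Lemma ent_onB (A B B' E : finType) (F : op R B -> op R B') (X : op R (A * B * E)) x y :
  ent (onB F X) x y = ent (F (slice_onB X x.1.1 y.1.1 x.2 y.2)) x.1.2 y.1.2.
Proof.
rewrite /onB ent_reindex ent_idtens /=; congr (ent (F _) _ _).
by apply: mkop_ext => a a'; rewrite ent_reindex.
Qed.

Lemma trE (T : finType) (X : op R T) : \tr X = \sum_x ent X x x.
Proof. by rewrite /mxtrace sum_enum_rank. Qed.

Lemma tr_reindex (S T : finType) (f : S -> T) (X : op R T) : bijective f ->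
  \tr (reindex f X) = \tr X.
Proof.
move=> fb; rewrite !trE [RHS](bigop.reindex _ (onW_bij _ fb)).
by apply: eq_bigr => x _; rewrite ent_reindex.
Qed.

Lemma tr_tens (S T : finType) (X : op R S) (Y : op R T) : \tr (tens X Y) = \tr X * \tr Y.
Proof.
rewrite !trE big_distrlr /= pair_bigA /=.
by apply: eq_bigr => x _; rewrite ent_tens.
Qed.

Lemma tr_ptrace1 (S T : finType) (X : op R (S * T)) : \tr (ptrace1 X) = \tr X.
Proof.
rewrite !trE (eq_bigr (fun x => \sum_s ent X (s, x) (s, x))); last first.
  by move=> x _; rewrite ent_ptrace1.
by rewrite exchange_big pair_bigA /=; apply: eq_bigr => -[].
Qed.

Lemma tr_ptrace2 (S T : finType) (X : op R (S * T)) : \tr (ptrace2 X) = \tr X.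
Proof.
rewrite !trE (eq_bigr (fun x => \sum_s ent X (x, s) (x, s))); last first.
  by move=> x _; rewrite ent_ptrace2.
by rewrite pair_bigA /=; apply: eq_bigr => -[].
Qed.

(** The argument is a function on the labels instead of a column vector, so that a change of index
    type needs no enumeration. *)
Definition qform (T : finType) (X : op R T) (v : T -> C) : C :=
  \sum_x \sum_y (v x)^*%R * ent X x y * v y.

Lemma qform_mx (T : finType) (X : op R T) (v : vec R T) :
  (v ^t* *m X *m v) 0 0 = qform X (fun x => v (enum_rank x) 0).
Proof.
rewrite mxE sum_enum_rank /qform exchange_big; apply: eq_bigr => y _.
rewrite mxE sum_enum_rank mulr_suml; apply: eq_bigr => x _.
by rewrite !mxE.
Qed.

Lemma psdP (T : finType) (X : op R T) : psd X <-> forall v, 0 <= qform X v.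
Proof.
split=> [h v|h v]; last by rewrite qform_mx.
have := h (\col_i v (enum_val i)); rewrite qform_mx.
congr (_ <= _); apply: eq_bigr => x _; apply: eq_bigr => y _.
by rewrite !mxE !enum_rankK.
Qed.

(** The form of the reindexed operator at v is the form of X at the sums of v over the fibres of f;
    thus f can be any map. *)
Lemma psd_reindex (S T : finType) (f : S -> T) (X : op R T) : psd X -> psd (reindex f X).
Proof.
move=> /psdP h; apply/psdP => v.
have := h (fun t => \sum_(s | f s == t) v s); congr (_ <= _).
rewrite /qform [RHS](partition_big f predT) //=; apply: eq_bigr => x _.
under [RHS]eq_bigr => s _ do rewrite (partition_big f predT) //=.
rewrite [RHS]exchange_big; apply: eq_bigr => y _.
rewrite rmorph_sum /= !mulr_suml; apply: eq_bigr => s /eqP fs.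
rewrite mulr_sumr; apply: eq_bigr => s' /eqP fs'.
by rewrite ent_reindex fs fs'.
Qed.

Lemma psd0 (T : finType) : psd (0 : op R T).
Proof. by move=> v; rewrite mulmx0 mul0mx mxE. Qed.

Lemma psd_add (T : finType) (X Y : op R T) : psd X -> psd Y -> psd (X + Y).
Proof. by move=> hX hY v; rewrite mulmxDr mulmxDl mxE addr_ge0. Qed.

Lemma psd_scale (T : finType) c (X : op R T) : 0 <= c -> psd X -> psd (c *: X).
Proof. by move=> hc hX v; rewrite -scalemxAr -scalemxAl mxE mulr_ge0. Qed.

Lemma psd_sum (T I : finType) (P : pred I) (X : I -> op R T) :
  (forall i, P i -> psd (X i)) -> psd (\sum_(i | P i) X i).
Proof.
move=> h; apply: (big_ind (@psd R T)) => [||i Pi].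
- exact: psd0.
- exact: psd_add.
- exact: h.
Qed.

Lemma ptrace1E (S T : finType) (X : op R (S * T)) :
  ptrace1 X = \sum_s reindex (fun t => (s, t)) X.
Proof.
by apply: opP => x y; rewrite ent_ptrace1 ent_sum; apply: eq_bigr => s _; rewrite ent_reindex.
Qed.

Lemma psd_ptrace1 (S T : finType) (X : op R (S * T)) : psd X -> psd (ptrace1 X).
Proof. by move=> h; rewrite ptrace1E; apply: psd_sum => s _; apply: psd_reindex. Qed.

Lemma psd_proj (T : finType) (v : vec R T) : psd (proj v).
Proof.
move=> w; rewrite /proj mulmxA -mulmxA.
have -> : v ^t* *m w = (w ^t* *m v) ^t*.
  by rewrite trmx_mul map_mxM trmxCK.
by rewrite mxE big_ord1 !mxE mul_conjC_ge0.
Qed.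

Lemma psd_tr_ge0 (T : finType) (X : op R T) : psd X -> 0 <= \tr X.
Proof.
move=> /psdP h; rewrite trE; apply: sumr_ge0 => x _.
have := h (fun y => (y == x)%:R); congr (_ <= _); rewrite /qform.
rewrite (bigD1 x) //= [X in _ + X]big1 ?addr0; last first.
  by move=> z zx; rewrite big1 // => y _; rewrite (negPf zx) conjC0 !mul0r.
rewrite (bigD1 x) //= [X in _ + X]big1 ?addr0; last first.
  by move=> z zx; rewrite (negPf zx) mulr0.
by rewrite eqxx conjC1 mul1r mulr1.
Qed.

End Entries.

(** * The trace norm of Hermitian operators *)

Lemma half_sumBE (F : numFieldType) (x y : F) : x = (y + x) / 2 - (y - x) / 2.
Proof. by field. Qed.

Lemma half_sumDE (F : numFieldType) (x y : F) : (y + x) / 2 + (y - x) / 2 = y.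
Proof. by field. Qed.

(** * Spectra of normal and Hermitian matrices *)

Section Spectral.
Variable C : numClosedFieldType.

Lemma adjmxM m n p (A : 'M[C]_(m, n)) (B : 'M[C]_(n, p)) :
  (A *m B) ^t* = B ^t* *m A ^t*.
Proof. by rewrite trmx_mul map_mxM. Qed.

Lemma unitarymxl n (U : 'M[C]_n) : U \is unitarymx -> U ^t* *m U = 1%:M.
Proof.
by move=> Uu; rewrite -(invmx_unitary Uu) mulVmx // unitarymx_unit.
Qed.

Lemma normal_spectral n (A : 'M[C]_n) : A *m A ^t* = A ^t* *m A ->
  exists2 U : 'M[C]_n, U \is unitarymx &
    exists d : 'rV[C]_n, A = U ^t* *m diag_mx d *m U.
Proof.
move=> /normalmxP /orthomx_spectralP; rewrite invmx_unitary ?spectral_unitarymx // => AE.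
by exists (spectralmx A); [exact: spectral_unitarymx|exists (spectral_diag A)].
Qed.

(** Eigenvalues are values of the quadratic form at the conjugated rows of U, so their reality and
    sign can be read off the form. *)
Lemma spectral_diagE n (A U : 'M[C]_n) (d : 'rV[C]_n) : U \is unitarymx ->
  A = U ^t* *m diag_mx d *m U ->
  forall i, d 0 i = ((row i U)^t*^t* *m A *m (row i U)^t*) 0 0.
Proof.
move=> Uu AE i; have UU : U *m U ^t* = 1%:M by apply/unitarymxP.
have <- : (U *m A *m U ^t*) i i = d 0 i.
  by rewrite AE !mulmxA UU mul1mx -mulmxA UU mulmx1 mxE eqxx mulr1n.
rewrite trmxCK -row_mul [LHS]mxE [RHS]mxE; apply: eq_bigr => j _.
by rewrite [row i _ _ _]mxE !mxE.
Qed.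

(** The difference of A and its adjoint is anti-Hermitian, hence normal, and each of its eigenvalues
    is q minus the conjugate of q for some real value q of the form of A. *)
Lemma qform_real_hermitian n (A : 'M[C]_n) :
  (forall v : 'cV[C]_n, (v ^t* *m A *m v) 0 0 \is Num.real) -> A ^t* = A.
Proof.
move=> h; apply/esym/eqP; rewrite -subr_eq0; apply/eqP.
set H := A - A ^t*.
have HC : H ^t* = - H.
  by rewrite /H raddfB /= map_mxB trmxCK opprB.
have [U Uu [d HE]] : exists2 U : 'M[C]_n, U \is unitarymx &
    exists d : 'rV[C]_n, H = U ^t* *m diag_mx d *m U.
  by apply: normal_spectral; rewrite HC mulmxN mulNmx.
suff d0 : d = 0.
  rewrite HE d0; have -> : diag_mx (0 : 'rV[C]_n) = 0.
    by apply/matrixP => i j; rewrite !mxE mul0rn.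
  by rewrite mulmx0 mul0mx.
apply/rowP => i; rewrite (spectral_diagE Uu HE).
set v := (row i U)^t*.
rewrite /H mulmxBr mulmxBl mxE [X in _ + X]mxE.
have -> : v ^t* *m A ^t* *m v = (v ^t* *m A *m v) ^t*.
  by rewrite !adjmxM trmxCK mulmxA.
by rewrite [X in _ - X]mxE [X in _ - X^*]mxE (CrealP (h v)) subrr mxE.
Qed.

(** [trace_norm] uses the eigenbasis V that [spectralmx] picks for the square of A, which may differ
    from U. The unitary W between the two bases intertwines D^2 with e, hence, entry by entry, |D|
    with sqrt e; similar matrices have the same trace. *)
Lemma sum_sqrt_spectral n (A U : 'M[C]_n) (D : 'rV[C]_n) : U \is unitarymx ->
  (forall i, D 0 i \is Num.real) -> A = U ^t* *m diag_mx D *m U ->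
  \sum_i sqrtC (spectral_diag (A ^t* *m A) 0 i) = \sum_i `|D 0 i|.
Proof.
move=> Uu Dr AE.
have UU : U *m U ^t* = 1%:M by apply/unitarymxP.
have AC : A ^t* = A.
  rewrite AE !adjmxM trmxCK mulmxA tr_diag_mx map_diag_mx; congr (_ *m diag_mx _ *m _).
  by apply/rowP => i; rewrite mxE; apply/CrealP.
set B := A ^t* *m A; set V := spectralmx B; set e := spectral_diag B.
have Vu : V \is unitarymx := spectral_unitarymx B.
have VV : V *m V ^t* = 1%:M by apply/unitarymxP.
have BE : B = V ^t* *m diag_mx e *m V.
  rewrite -invmx_unitary //; apply/orthomx_spectralP/normalmxP.
  by rewrite /B adjmxM trmxCK.
have BE2 : B = U ^t* *m (diag_mx D *m diag_mx D) *m U.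
  by rewrite /B AC {1 2}AE -!mulmxA (mulmxA U) UU mul1mx.
set W := U *m V ^t*.
have comm : diag_mx D *m diag_mx D *m W = W *m diag_mx e.
  have -> : diag_mx D *m diag_mx D *m W = U *m B *m V ^t*.
    by rewrite BE2 /W !mulmxA UU mul1mx.
  by rewrite BE /W -!mulmxA VV mulmx1.
have commW : diag_mx (\row_i `|D 0 i|) *m W = W *m diag_mx (\row_i sqrtC (e 0 i)).
  apply/matrixP => i j; rewrite mul_diag_mx mul_mx_diag !mxE.
  have /matrixP/(_ i j) := comm; rewrite -mulmxA !mul_diag_mx mul_mx_diag !mxE.
  set w := (\sum_(_ < _) _); have [->|w0] := eqVneq w 0; first by move=> _; rewrite mulr0 mul0r.
  rewrite mulrA mulrC => /(mulfI w0) <-; rewrite mulrC; congr (_ * _).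
  by rewrite -expr2 -(real_normK (Dr i)) sqrCK.
have WW : W *m W ^t* = 1%:M.
  by rewrite /W adjmxM trmxCK -!mulmxA (mulmxA _ V) unitarymxl // mul1mx.
have WW' : W ^t* *m W = 1%:M by apply: unitarymxl; apply/unitarymxP.
have trd (d : 'rV[C]_n) : \tr (diag_mx d) = \sum_i d 0 i by exact: mxtrace_diag.
transitivity (\tr (diag_mx (\row_i sqrtC (e 0 i)))).
  by rewrite trd; apply: eq_bigr => i _; rewrite mxE.
transitivity (\tr (diag_mx (\row_i `|D 0 i|))); last first.
  by rewrite trd; apply: eq_bigr => i _; rewrite mxE.
by rewrite -[X in \tr X = _]mul1mx -WW' -mulmxA -commW mxtrace_mulC -mulmxA WW mulmx1.
Qed.

End Spectral.

Section TraceNorm.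
Variable R : realType.
Local Notation C := R[i].

Lemma psd_herm (T : finType) (X : op R T) : psd X -> X ^t* = X.
Proof. by move=> h; apply: qform_real_hermitian => v; exact/ger0_real/h. Qed.

Lemma hermitian_spectral (T : finType) (X : op R T) : X ^t* = X ->
  exists2 U : op R T, U \is unitarymx & exists2 d : 'rV[C]_#|{: T}|,
    (forall i, d 0 i \is Num.real) & X = U ^t* *m diag_mx d *m U.
Proof.
move=> XC; have [U Uu [d XE]] : exists2 U : op R T, U \is unitarymx &
    exists d : 'rV[C]_#|{: T}|, X = U ^t* *m diag_mx d *m U.
  by apply: normal_spectral; rewrite XC.
exists U => //; exists d => // i; apply/CrealP.
rewrite (spectral_diagE Uu XE).
set v := (row i U)^t*.
have {1}<- : (v ^t* *m X *m v) ^t* = v ^t* *m X *m v.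
  by rewrite !adjmxM trmxCK XC mulmxA.
by rewrite [X in X^*]mxE [X in X^*^*]mxE conjCK.
Qed.

Lemma psd_diag (T : finType) (U : op R T) (d : 'rV[C]_#|{: T}|) :
  (forall i, 0 <= d 0 i) -> psd (U ^t* *m diag_mx d *m U).
Proof.
move=> d0 v.
have -> : v ^t* *m (U ^t* *m diag_mx d *m U) *m v = (U *m v) ^t* *m diag_mx d *m (U *m v).
  by rewrite adjmxM !mulmxA.
rewrite -mulmxA mul_diag_mx mxE; apply: sumr_ge0 => i _.
by rewrite !mxE mulrCA; apply: mulr_ge0 => //; rewrite mulrC mul_conjC_ge0.
Qed.

Lemma psd_gram (T : finType) (X : op R T) : psd X -> exists G : op R T, X = G ^t* *m G.
Proof.
move=> hX; have [U Uu [d dr XE]] := hermitian_spectral (psd_herm hX).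
have d0 i : 0 <= d 0 i by rewrite (spectral_diagE Uu XE); apply: hX.
exists (diag_mx (\row_i sqrtC (d 0 i)) *m U).
rewrite adjmxM XE !mulmxA; congr (_ *m _); rewrite -mulmxA; congr (_ *m _).
rewrite tr_diag_mx map_diag_mx; apply/matrixP => i j; rewrite mul_diag_mx !mxE.
rewrite mulrnAr; congr (_ *+ _).
have sr : sqrtC (d 0 i) \is Num.real by rewrite ger0_real ?sqrtC_ge0.
by rewrite [X in X * _](CrealP sr) -expr2 sqrtCK.
Qed.

(** The functions [g k] serve as Kraus operators of a measurement, and they turn positivity of
    products into sums of nonnegative terms. *)
Lemma psd_gram_ent (T : finType) (X : op R T) : psd X -> exists g : T -> T -> C,
  forall x y, ent X x y = \sum_k (g k x)^*%R * g k y.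
Proof.
move=> /psd_gram[G ->]; exists (ent G) => x y.
by rewrite ent_mul; apply: eq_bigr => k _; rewrite ent_trC.
Qed.

Lemma tr_diag_conj n (U : 'M[C]_n) d : U \is unitarymx ->
  \tr (U ^t* *m diag_mx d *m U) = \sum_i d 0 i.
Proof.
move=> /unitarymxP UU; rewrite -mulmxA mxtrace_mulC -mulmxA UU mulmx1.
exact: mxtrace_diag.
Qed.

(* The two lemmas below characterise the trace norm of a Hermitian operator as
   the minimum of tr P + tr Q over its decompositions P - Q with P, Q >= 0. *)
Lemma trace_norm_attained (T : finType) (X : op R T) : X ^t* = X ->
  exists P Q : op R T, [/\ psd P, psd Q, X = P - Q &
    trace_norm X = complex.Re (\tr P + \tr Q)].
Proof.
move=> XC; have [U Uu [d dr XE]] := hermitian_spectral XC.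
exists (U ^t* *m diag_mx (\row_i ((`|d 0 i| + d 0 i) / 2)) *m U).
exists (U ^t* *m diag_mx (\row_i ((`|d 0 i| - d 0 i) / 2)) *m U).
split.
- apply: psd_diag => i; rewrite mxE divr_ge0 ?ler0n //.
  by rewrite -[X in _ + X]opprK subr_ge0 -normrN real_ler_norm ?rpredN.
- apply: psd_diag => i; rewrite mxE divr_ge0 ?ler0n //.
  by rewrite subr_ge0 real_ler_norm.
- rewrite -mulmxBl -mulmxBr {1}XE; congr (_ *m _ *m _).
  apply/matrixP => i j; rewrite !mxE -mulrnBl; congr (_ *+ _).
  exact: half_sumBE.
- rewrite /trace_norm (sum_sqrt_spectral Uu dr XE) !tr_diag_conj // -big_split.
  congr complex.Re; apply: eq_bigr => i _ /=; rewrite !mxE; exact/esym/half_sumDE.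
Qed.

Lemma trace_norm_sub_le (T : finType) (P Q : op R T) : psd P -> psd Q ->
  trace_norm (P - Q) <= complex.Re (\tr P + \tr Q).
Proof.
move=> hP hQ.
have XC : (P - Q) ^t* = P - Q.
  by rewrite raddfB /= map_mxB (psd_herm hP) (psd_herm hQ).
have [U Uu [d dr XE]] := hermitian_spectral XC.
rewrite /trace_norm (sum_sqrt_spectral Uu dr XE).
suff : \sum_i `|d 0 i| <= \tr P + \tr Q by rewrite lecE => /andP[].
have trE (Y : op R T) : \tr Y = \sum_i ((row i U)^t*^t* *m Y *m (row i U)^t*) 0 0.
  have -> : \tr Y = \tr (U *m Y *m U ^t*).
    by rewrite mxtrace_mulC mulmxA unitarymxl // mul1mx.
  apply: eq_bigr => i _; rewrite trmxCK -row_mul.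
  by rewrite !mxE; apply: eq_bigr => j _; rewrite !mxE.
rewrite (trE P) (trE Q) -big_split; apply: ler_sum => i _.
rewrite (spectral_diagE Uu XE); set v := (row i U)^t*.
rewrite mulmxBr mulmxBl mxE [X in _ + X]mxE.
by rewrite (le_trans (ler_normB _ _)) // !ger0_norm.
Qed.

Lemma trace_norm_ge0 (T : finType) (X : op R T) : X ^t* = X -> 0 <= trace_norm X.
Proof.
move=> /trace_norm_attained[P [Q [/psd_tr_ge0 hP /psd_tr_ge0 hQ _ ->]]].
by have := addr_ge0 hP hQ; rewrite lecE => /andP[].
Qed.

End TraceNorm.

(** * Behaviour of the trace norm under maps, products and block sums *)

Section TraceNormMaps.
Variable R : realType.
Local Notation C := R[i].

Definition rtr (T : finType) (X : op R T) : R := complex.Re (\tr X).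

Lemma Re_add (x y : C) : complex.Re (x + y) = complex.Re x + complex.Re y.
Proof. by case: x y => [a b] [c d]. Qed.

Lemma Re_ge0 (x : C) : 0 <= x -> 0 <= complex.Re x.
Proof. by rewrite lecE => /andP[]. Qed.

Lemma ge0_ReE (x : C) : 0 <= x -> x = (complex.Re x)%:C%C.
Proof. by move=> x0; rewrite RRe_real ?ger0_real. Qed.

Lemma rtrE (T : finType) (X : op R T) : psd X -> \tr X = (rtr X)%:C%C.
Proof. by move=> /psd_tr_ge0 h; apply: ge0_ReE. Qed.

Lemma rtr_ge0 (T : finType) (X : op R T) : psd X -> 0 <= rtr X.
Proof. by move=> /psd_tr_ge0/Re_ge0. Qed.

Lemma herm_sub (T : finType) (X Y : op R T) : X ^t* = X -> Y ^t* = Y -> (X - Y) ^t* = X - Y.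
Proof. by move=> XC YC; rewrite raddfB /= map_mxB XC YC. Qed.

Lemma psd_sub_herm (T : finType) (X Y : op R T) : psd X -> psd Y -> (X - Y) ^t* = X - Y.
Proof. by move=> /psd_herm XC /psd_herm YC; apply: herm_sub. Qed.

(** With Y written as a Gram matrix, the form of the tensor product at v is a sum over k of forms of
    X, taken at v contracted with the k-th Gram vector. *)
Lemma psd_tens (S T : finType) (X : op R S) (Y : op R T) : psd X -> psd Y -> psd (tens X Y).
Proof.
move=> /psdP hX /psd_gram_ent[g gE]; apply/psdP => v.
suff -> : qform (tens X Y) v = \sum_k qform X (fun s => \sum_t g k t * v (s, t)).
  by apply: sumr_ge0 => k _; apply: hX.
rewrite /qform.
rewrite sum_pair [RHS]exchange_big; apply: eq_bigr => s _ /=.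
under eq_bigr => t _ do rewrite sum_pair.
rewrite exchange_big [RHS]exchange_big /=; apply: eq_bigr => s' _ /=.
under eq_bigr => t _ do under eq_bigr => t' _ do
  rewrite ent_tens /= gE mulrAC !mulr_sumr.
under eq_bigr => t _ do rewrite exchange_big /=.
rewrite exchange_big /=; apply: eq_bigr => k _.
rewrite rmorph_sum /= !mulr_suml; apply: eq_bigr => t _.
rewrite !mulr_sumr; apply: eq_bigr => t' _.
rewrite rmorphM /=; ring.
Qed.

(** F sends an optimal decomposition of X to a decomposition of F X with the same total trace. *)
Lemma trace_norm_contract (S T : finType) (F : op R S -> op R T) (X : op R S) :
  X ^t* = X ->
  (forall P Q, F (P - Q) = F P - F Q) -> (forall P, psd P -> psd (F P)) ->
  (forall P, \tr (F P) = \tr P) -> trace_norm (F X) <= trace_norm X.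
Proof.
move=> /trace_norm_attained[P [Q [hP hQ -> ->]]] FB Fpsd Ftr.
by rewrite FB -(Ftr P) -(Ftr Q); apply: trace_norm_sub_le; apply: Fpsd.
Qed.

Lemma trace_normD (T : finType) (X Y : op R T) : X ^t* = X -> Y ^t* = Y ->
  trace_norm (X + Y) <= trace_norm X + trace_norm Y.
Proof.
move=> /trace_norm_attained[P [Q [hP hQ -> ->]]].
move=> /trace_norm_attained[P' [Q' [hP' hQ' -> ->]]].
rewrite -Re_add [X in complex.Re X]addrACA -(mxtraceD P) -(mxtraceD Q).
rewrite [X in trace_norm X]addrACA -opprD.
by apply: trace_norm_sub_le; apply: psd_add.
Qed.

Lemma trace_normZ (T : finType) (c : C) (X : op R T) : 0 <= c -> X ^t* = X ->
  trace_norm (c *: X) <= complex.Re c * trace_norm X.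
Proof.
move=> c0 /trace_norm_attained[P [Q [hP hQ -> ->]]].
rewrite scalerBr; apply: le_trans (trace_norm_sub_le (psd_scale c0 hP) (psd_scale c0 hQ)) _.
rewrite !mxtraceZ -mulrDr {1}(ge0_ReE c0).
by case: (\tr P + \tr Q) => a b /=; rewrite mul0r subr0.
Qed.

Lemma Re_mul_ge0 (x y : C) : 0 <= y -> complex.Re (x * y) = complex.Re x * complex.Re y.
Proof. by move=> /ge0_ReE ->; case: x => a b /=; rewrite mulr0 subr0. Qed.

Lemma tensBl (S T : finType) (X X' : op R S) (Y : op R T) :
  tens (X - X') Y = tens X Y - tens X' Y.
Proof. by apply: opP => x y; rewrite ent_add ent_opp !ent_tens ent_add ent_opp mulrBl. Qed.

Lemma tensBr (S T : finType) (X : op R S) (Y Y' : op R T) :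
  tens X (Y - Y') = tens X Y - tens X Y'.
Proof. by apply: opP => x y; rewrite ent_add ent_opp !ent_tens ent_add ent_opp mulrBr. Qed.

Lemma trace_norm_tensl (S T : finType) (X : op R S) (Y : op R T) : X ^t* = X -> psd Y ->
  trace_norm (tens X Y) <= trace_norm X * rtr Y.
Proof.
move=> /trace_norm_attained[P [Q [hP hQ -> ->]]] hY.
rewrite tensBl; apply: le_trans (trace_norm_sub_le (psd_tens hP hY) (psd_tens hQ hY)) _.
by rewrite !tr_tens -mulrDl Re_mul_ge0 // psd_tr_ge0.
Qed.

Lemma trace_norm_tensr (S T : finType) (X : op R S) (Y : op R T) : psd X -> Y ^t* = Y ->
  trace_norm (tens X Y) <= rtr X * trace_norm Y.
Proof.
move=> hX /trace_norm_attained[P [Q [hP hQ -> ->]]].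
rewrite tensBr; apply: le_trans (trace_norm_sub_le (psd_tens hX hP) (psd_tens hX hQ)) _.
by rewrite !tr_tens -mulrDr mulrC Re_mul_ge0 ?psd_tr_ge0 // mulrC.
Qed.

Lemma reindexB (S T : finType) (f : S -> T) (X Y : op R T) :
  reindex f (X - Y) = reindex f X - reindex f Y.
Proof. by apply: opP => x y; rewrite ent_add ent_opp !ent_reindex ent_add ent_opp. Qed.

Lemma trace_norm_reindex (S T : finType) (f : S -> T) (X : op R T) : bijective f ->
  X ^t* = X -> trace_norm (reindex f X) <= trace_norm X.
Proof.
move=> fb XC; apply: trace_norm_contract => // [P Q|P|P].
- exact: reindexB.
- exact: psd_reindex.
- exact: tr_reindex.
Qed.

(** A state with a classical register T: the block X t is the unnormalised state for the register
    value t. *)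
Definition blocks (S T : finType) (X : T -> op R S) : op R (S * T) :=
  mkop (fun x y => if x.2 == y.2 then ent (X x.2) x.1 y.1 else 0).

Lemma psd_blocks (S T : finType) (X : T -> op R S) : (forall t, psd (X t)) -> psd (blocks X).
Proof.
move=> h; apply/psdP => v.
suff -> : qform (blocks X) v = \sum_t qform (X t) (fun s => v (s, t)).
  by apply: sumr_ge0 => t _; move/psdP: (h t); apply.
rewrite /qform.
have sumP (F : S * T -> C) : \sum_x F x = \sum_t \sum_s F (s, t).
  by rewrite exchange_big pair_bigA; apply: eq_bigr => -[].
rewrite sumP; apply: eq_bigr => t _; apply: eq_bigr => s _.
rewrite sumP (bigD1 t) //= [X in _ + X]big1 ?addr0.
  by apply: eq_bigr => s' _; rewrite ent_mkop eqxx.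
move=> t' /negPf tt'; rewrite big1 // => s' _.
by rewrite ent_mkop /= eq_sym tt' mulr0 mul0r.
Qed.

Lemma tr_blocks (S T : finType) (X : T -> op R S) : \tr (blocks X) = \sum_t \tr (X t).
Proof.
rewrite trE; under [RHS]eq_bigr => t _ do rewrite trE.
by rewrite exchange_big pair_bigA; apply: eq_bigr => -[s t] _; rewrite ent_mkop eqxx.
Qed.

Lemma blocksB (S T : finType) (X Y : T -> op R S) :
  blocks (fun t => X t - Y t) = blocks X - blocks Y.
Proof.
apply: opP => x y; rewrite ent_add ent_opp !ent_mkop.
by case: ifP => _; rewrite ?ent_add ?ent_opp ?subrr.
Qed.

(* Pinching: the diagonal blocks of a decomposition of [blocks X] decompose each X t. *)
Lemma trace_norm_blocks (S T : finType) (X : T -> op R S) : (forall t, (X t) ^t* = X t) ->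
  trace_norm (blocks X) = \sum_t trace_norm (X t).
Proof.
move=> hX; apply/eqP; rewrite eq_le; apply/andP; split.
  have [P PE] := boolp.choice (fun t => trace_norm_attained (hX t)).
  have [Q PQ] := boolp.choice PE.
  have -> : X = fun t => P t - Q t by apply: funext => t; case: (PQ t).
  rewrite blocksB (le_trans (trace_norm_sub_le _ _)) //.
  + by apply: psd_blocks => t; case: (PQ t).
  + by apply: psd_blocks => t; case: (PQ t).
  rewrite !tr_blocks -big_split /= (big_morph _ Re_add erefl).
  by apply: ler_sum => t _; case: (PQ t) => _ _ <- ->.
have XC : (blocks X) ^t* = blocks X.
  apply: opP => x y; rewrite ent_trC !ent_mkop eq_sym.
  case: eqP => [->|]; last by rewrite conjC0.
  by rewrite -ent_trC hX.
have [P [Q [hP hQ XE ->]]] := trace_norm_attained XC.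
have trB (Y : op R (S * T)) : \tr Y = \sum_t \tr (reindex (fun s => (s, t)) Y).
  rewrite trE; under [RHS]eq_bigr => t _ do rewrite trE.
  by rewrite exchange_big pair_bigA; apply: eq_bigr => -[s t] _; rewrite ent_reindex.
rewrite (trB P) (trB Q) -big_split /= (big_morph _ Re_add erefl).
apply: ler_sum => t _.
have -> : X t = reindex (fun s => (s, t)) P - reindex (fun s => (s, t)) Q.
  by rewrite -reindexB -XE; apply: opP => x y; rewrite ent_reindex ent_mkop eqxx.
by apply: trace_norm_sub_le; apply: psd_reindex.
Qed.

End TraceNormMaps.

(** * Protocols, summed over their transcripts *)

Section Protocols.
Variable R : realType.
Local Notation C := R[i].

(** The free summand G acts as a continuation: induction on P and composition of protocols go
    through without relating transcript types. *)
Definition runsum (V : nmodType) (E KA KB A B : finType) (P : lopc R KA KB A B)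
  (X : op R (A * B * E)) (G : op R (KA * KB * E) -> V) : V :=
  \sum_(t : transcript P) G (run X t).

Lemma runsum_Done (V : nmodType) (E KA KB : finType) (X : op R (KA * KB * E))
  (G : op R (KA * KB * E) -> V) : runsum (Done R KA KB) X G = G X.
Proof. by rewrite /runsum (big_pred1 tt) // => -[]. Qed.

Lemma runsum_Alice (V : nmodType) (E KA KB A A' B M : finType) (F : instrument R A A' M)
  (next : M -> lopc R KA KB A' B) (X : op R (A * B * E)) (G : op R (KA * KB * E) -> V) :
  runsum (AliceTalks F next) X G = \sum_m runsum (next m) (onA (F m) X) G.
Proof.
by rewrite /runsum (sig_big_dep predT (fun _ => predT) (fun m t => G (run (onA (F m) X) t))).
Qed.

Lemma runsum_Bob (V : nmodType) (E KA KB A B B' M : finType) (F : instrument R B B' M)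
  (next : M -> lopc R KA KB A B') (X : op R (A * B * E)) (G : op R (KA * KB * E) -> V) :
  runsum (BobTalks F next) X G = \sum_m runsum (next m) (onB (F m) X) G.
Proof.
by rewrite /runsum (sig_big_dep predT (fun _ => predT) (fun m t => G (run (onB (F m) X) t))).
Qed.

Lemma onA_psd (A A' B E : finType) (F : op R A -> op R A') (X : op R (A * B * E)) :
  completely_positive F -> psd X -> psd (onA F X).
Proof. by move=> hF hX; apply: psd_reindex; apply: hF; apply: psd_reindex. Qed.

Lemma onB_psd (A B B' E : finType) (F : op R B -> op R B') (X : op R (A * B * E)) :
  completely_positive F -> psd X -> psd (onB F X).
Proof. by move=> hF hX; apply: psd_reindex; apply: hF; apply: psd_reindex. Qed.

Lemma run_psd (E KA KB A B : finType) (P : lopc R KA KB A B) (X : op R (A * B * E)) t :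
  psd X -> psd (run (P := P) X t).
Proof.
elim: P X t => //= [A0 A' B0 M F next IH X t hX|A0 B0 B' M F next IH X t hX].
  by apply: IH; apply: onA_psd hX; apply: branch_cp.
by apply: IH; apply: onB_psd hX; apply: branch_cp.
Qed.

Lemma runsum_le (E KA KB A B : finType) (P : lopc R KA KB A B) (X : op R (A * B * E))
  (G H : op R (KA * KB * E) -> R) : psd X -> (forall Y, psd Y -> G Y <= H Y) ->
  runsum P X G <= runsum P X H.
Proof. by move=> hX GH; apply: ler_sum => t _; apply: GH; apply: run_psd. Qed.

Lemma runsum_ge0 (E KA KB A B : finType) (P : lopc R KA KB A B) (X : op R (A * B * E))
  (G : op R (KA * KB * E) -> R) : psd X -> (forall Y, psd Y -> 0 <= G Y) -> 0 <= runsum P X G.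
Proof. by move=> hX h; apply: sumr_ge0 => t _; apply: h; apply: run_psd. Qed.

Lemma tr_sum3 (A B E : finType) (X : op R (A * B * E)) :
  \tr X = \sum_a \sum_b \sum_e ent X (a, b, e) (a, b, e).
Proof.
by rewrite trE !pair_bigA /=; apply: eq_bigr => -[[a b] e].
Qed.

Lemma onA_tr (A A' B E M : finType) (F : instrument R A A' M) (X : op R (A * B * E)) :
  \sum_m \tr (onA (F m) X) = \tr X.
Proof.
have step m : \tr (onA (F m) X) = \sum_b \sum_e \tr (F m (slice_onA X b b e e)).
  rewrite tr_sum3 exchange_big; apply: eq_bigr => b _; rewrite exchange_big.
  by apply: eq_bigr => e _; rewrite trE; apply: eq_bigr => a _; rewrite ent_onA.
under eq_bigr => m _ do rewrite step.
rewrite tr_sum3 exchange_big [RHS]exchange_big; apply: eq_bigr => b _ /=.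
rewrite exchange_big [RHS]exchange_big; apply: eq_bigr => e _ /=.
by rewrite branch_tp trE; apply: eq_bigr => a _; rewrite ent_mkop.
Qed.

Lemma onB_tr (A B B' E M : finType) (F : instrument R B B' M) (X : op R (A * B * E)) :
  \sum_m \tr (onB (F m) X) = \tr X.
Proof.
have step m : \tr (onB (F m) X) = \sum_a \sum_e \tr (F m (slice_onB X a a e e)).
  rewrite tr_sum3; apply: eq_bigr => a _; rewrite exchange_big.
  by apply: eq_bigr => e _; rewrite trE; apply: eq_bigr => b _; rewrite ent_onB.
under eq_bigr => m _ do rewrite step.
rewrite tr_sum3 exchange_big; apply: eq_bigr => a _ /=.
rewrite exchange_big [RHS]exchange_big; apply: eq_bigr => e _ /=.
by rewrite branch_tp trE; apply: eq_bigr => b _; rewrite ent_mkop.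
Qed.

Lemma runsum_tr (E KA KB A B : finType) (P : lopc R KA KB A B) (X : op R (A * B * E)) :
  runsum P X (fun Y => \tr Y) = \tr X.
Proof.
elim: P X => [|A0 A' B0 M F next IH|A0 B0 B' M F next IH] X.
- exact: runsum_Done.
- by rewrite runsum_Alice -(onA_tr F); apply: eq_bigr => m _; apply: IH.
- by rewrite runsum_Bob -(onB_tr F); apply: eq_bigr => m _; apply: IH.
Qed.

Lemma runsum_rtr (E KA KB A B : finType) (P : lopc R KA KB A B) (X : op R (A * B * E)) :
  runsum P X (fun Y => rtr Y) = rtr X.
Proof. by rewrite /rtr -(runsum_tr P X) /runsum (big_morph _ (@Re_add R) erefl). Qed.

(** One shape for three operations on Eve's system: discarding F (w = 1, h identifying F * E' with
    E), adjoining a further state (w its entries), and scaling (w constant). *)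
Definition evemap (S E E' F : finType) (w : F -> E' -> E' -> C) (h : F -> E' -> E)
    (X : op R (S * E)) : op R (S * E') :=
  mkop (fun x y => \sum_f w f x.2 y.2 * ent X (x.1, h f x.2) (y.1, h f y.2)).

Lemma onA_evemap (A A' B E E' I : finType) (F : {linear op R A -> op R A'})
  (w : I -> E' -> E' -> C) (h : I -> E' -> E) (X : op R (A * B * E)) :
  onA F (evemap w h X) = evemap w h (onA F X).
Proof.
apply: opP => x y; rewrite ent_onA [RHS]ent_mkop.
have -> : slice_onA (evemap w h X) x.1.2 y.1.2 x.2 y.2 =
    \sum_i w i x.2 y.2 *: slice_onA X x.1.2 y.1.2 (h i x.2) (h i y.2).
  apply: opP => a a'; rewrite !ent_mkop ent_sum; apply: eq_bigr => i _.
  by rewrite ent_scale ent_mkop.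
rewrite linear_sum ent_sum; apply: eq_bigr => i _.
by rewrite linearZ ent_scale ent_onA.
Qed.

Lemma onB_evemap (A B B' E E' I : finType) (F : {linear op R B -> op R B'})
  (w : I -> E' -> E' -> C) (h : I -> E' -> E) (X : op R (A * B * E)) :
  onB F (evemap w h X) = evemap w h (onB F X).
Proof.
apply: opP => x y; rewrite ent_onB [RHS]ent_mkop.
have -> : slice_onB (evemap w h X) x.1.1 y.1.1 x.2 y.2 =
    \sum_i w i x.2 y.2 *: slice_onB X x.1.1 y.1.1 (h i x.2) (h i y.2).
  apply: opP => a a'; rewrite !ent_mkop ent_sum; apply: eq_bigr => i _.
  by rewrite ent_scale ent_mkop.
rewrite linear_sum ent_sum; apply: eq_bigr => i _.
by rewrite linearZ ent_scale ent_onB.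
Qed.

(** The instruments are linear and act separately for each pair of Eve's indices, so they commute
    with [evemap] in every round. *)
Lemma runsum_evemap (V : nmodType) (E E' KA KB A B I : finType) (P : lopc R KA KB A B)
  (w : I -> E' -> E' -> C) (h : I -> E' -> E)
  (X : op R (A * B * E)) (G : op R (KA * KB * E') -> V) :
  runsum P (evemap w h X) G = runsum P X (fun Y => G (evemap w h Y)).
Proof.
elim: P X G => [|A0 A' B0 M F next IH|A0 B0 B' M F next IH] X G.
- by rewrite !runsum_Done.
- by rewrite !runsum_Alice; apply: eq_bigr => m _; rewrite onA_evemap IH.
- by rewrite !runsum_Bob; apply: eq_bigr => m _; rewrite onB_evemap IH.
Qed.

Fixpoint seq_lopc (KA KB A B KA' KB' : finType) (P : lopc R KA KB A B)
    (Q : lopc R KA' KB' KA KB) : lopc R KA' KB' A B :=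
  match P in lopc _ _ _ A B return lopc R KA' KB' A B with
  | Done => Q
  | AliceTalks _ _ _ _ F next => AliceTalks F (fun m => seq_lopc (next m) Q)
  | BobTalks _ _ _ _ F next => BobTalks F (fun m => seq_lopc (next m) Q)
  end.

Lemma runsum_seq (V : nmodType) (E KA KB A B KA' KB' : finType) (P : lopc R KA KB A B)
    (Q : lopc R KA' KB' KA KB) (X : op R (A * B * E)) (G : op R (KA' * KB' * E) -> V) :
  runsum (seq_lopc P Q) X G = runsum P X (fun Y => runsum Q Y G).
Proof.
elim: P X => [|A0 A' B0 M F next IH|A0 B0 B' M F next IH] X.
- by rewrite runsum_Done.
- by rewrite !runsum_Alice; apply: eq_bigr => m _; apply: IH.
- by rewrite !runsum_Bob; apply: eq_bigr => m _; apply: IH.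
Qed.

End Protocols.

(** * Kraus maps, relabellings, spectators and conjugate protocols *)

Section Combinators.
Variable R : realType.
Local Notation C := R[i].

Lemma reindex_comp (S T U : finType) (f : S -> T) (g : T -> U) (X : op R U) :
  reindex f (reindex g X) = reindex (g \o f) X.
Proof. by apply: opP => x y; rewrite !ent_reindex. Qed.

Lemma reindex_eqid (S : finType) (f : S -> S) (X : op R S) : f =1 id -> reindex f X = X.
Proof. by move=> h; apply: opP => x y; rewrite !ent_reindex !h. Qed.

Definition kraus_map (I A B : finType) (V : I -> B -> A -> C) (X : op R A) : op R B :=
  mkop (fun x y => \sum_k \sum_u \sum_v V k x u * ent X u v * (V k y v)^*%R).

Lemma kraus_map_linear (I A B : finType) (V : I -> B -> A -> C) :
  linear (kraus_map V).
Proof.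
move=> a X Y; apply: opP => x y; rewrite ent_add ent_scale !ent_mkop.
rewrite mulr_sumr -big_split; apply: eq_bigr => k _.
rewrite mulr_sumr -big_split; apply: eq_bigr => u _.
rewrite mulr_sumr -big_split; apply: eq_bigr => v _ /=.
rewrite ent_add ent_scale; ring.
Qed.

HB.instance Definition _ (I A B : finType) (V : I -> B -> A -> C) :=
  GRing.isLinear.Build C (op R A) (op R B) *:%R (kraus_map V) (kraus_map_linear V).

Lemma kraus_map_cp (I A B : finType) (V : I -> B -> A -> C) :
  completely_positive (kraus_map V).
Proof.
move=> T X /psdP hX; apply/psdP => v.
(* This is v after the adjoint of the k-th Kraus operator on the second factor. *)
pose w k (s : T * A) := \sum_b (V k b s.2)^*%R * v (s.1, b).
suff -> : qform (idtens (kraus_map V) X) v = \sum_k qform X (w k).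
  by apply: sumr_ge0.
rewrite /qform sum_pair.
under eq_bigr => t _ do under eq_bigr => b _ do rewrite sum_pair.
under [RHS]eq_bigr => k _ do rewrite sum_pair.
under [RHS]eq_bigr => k _ do under eq_bigr => t _ do under eq_bigr => a _ do rewrite sum_pair.
rewrite [RHS]exchange_big; apply: eq_bigr => t _ /=.
rewrite exchange_big /=.
under [RHS]eq_bigr => k _ do rewrite exchange_big /=.
rewrite [RHS]exchange_big; apply: eq_bigr => t' _ /=.
under [LHS]eq_bigr => b _ do under eq_bigr => b' _ do
  rewrite ent_idtens ent_mkop /= mulr_sumr mulr_suml.
under [LHS]eq_bigr => b _ do rewrite exchange_big /=.
rewrite exchange_big /=; apply: eq_bigr => k _.
under [LHS]eq_bigr => b _ do under eq_bigr => b' _ do rewrite mulr_sumr mulr_suml.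
under [LHS]eq_bigr => b _ do rewrite exchange_big /=.
rewrite exchange_big /=; apply: eq_bigr => a _.
under [LHS]eq_bigr => b _ do under eq_bigr => b' _ do rewrite mulr_sumr mulr_suml.
under [LHS]eq_bigr => b _ do rewrite exchange_big /=.
rewrite exchange_big /=; apply: eq_bigr => a' _.
rewrite /w /= rmorph_sum /= !mulr_suml; apply: eq_bigr => b _.
rewrite mulr_sumr; apply: eq_bigr => b' _.
by rewrite ent_mkop rmorphM /= conjCK; ring.
Qed.

Lemma kraus_map_tr (I A B : finType) (V : I -> B -> A -> C) (X : op R A) :
  \tr (kraus_map V X) =
  \sum_u \sum_v ent X u v * \sum_k \sum_x V k x u * (V k x v)^*%R.
Proof.
rewrite trE; under eq_bigr => x _ do rewrite ent_mkop.
under eq_bigr => x _ do under eq_bigr => k _ do rewrite pair_bigA /=.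
under eq_bigr => x _ do rewrite exchange_big /=.
rewrite exchange_big [RHS]pair_bigA /=; apply: eq_bigr => -[u v] _ /=.
rewrite exchange_big mulr_sumr; apply: eq_bigr => k _ /=.
by rewrite mulr_sumr; apply: eq_bigr => x _; ring.
Qed.

Section KrausInstrument.
Variables (M I A B : finType) (V : M -> I -> B -> A -> C).
Hypothesis Vtp : forall u v, \sum_m \sum_k \sum_x V m k x u * (V m k x v)^*%R = (u == v)%:R.

Lemma kraus_tp X : \sum_m \tr (kraus_map (V m) X) = \tr X.
Proof.
under eq_bigr => m _ do rewrite kraus_map_tr.
rewrite exchange_big trE; apply: eq_bigr => u _ /=.
rewrite exchange_big /= (bigD1 u) //= [X in _ + X]big1 ?addr0.
  by rewrite -mulr_sumr Vtp eqxx mulr1.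
by move=> v /negPf uv; rewrite -mulr_sumr Vtp eq_sym uv mulr0.
Qed.

Definition kraus_instrument : instrument R A B M :=
  Instrument (branch := fun m => kraus_map (V m) : {linear op R A -> op R B})
    (fun m => @kraus_map_cp _ _ _ (V m)) kraus_tp.

End KrausInstrument.

Lemma reindex_linear (A B : finType) (f : B -> A) : linear (@reindex R B A f).
Proof. by move=> a X Y; apply: opP => x y; rewrite ?(ent_add, ent_scale, ent_reindex). Qed.

HB.instance Definition _ (A B : finType) (f : B -> A) :=
  GRing.isLinear.Build C (op R A) (op R B) *:%R (@reindex R B A f) (reindex_linear f).

Lemma reindex_cp (A B : finType) (f : B -> A) : completely_positive (@reindex R B A f).
Proof.
move=> T X hX; suff -> : idtens (reindex f) X = reindex (fun x => (x.1, f x.2)) X.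
  exact: psd_reindex.
by apply: opP => x y; rewrite ent_idtens !ent_reindex ent_mkop.
Qed.

Lemma reindex_tp (A B : finType) (f : B -> A) : bijective f -> forall X,
  \sum_(m : unit) \tr (@reindex R B A f X) = \tr X.
Proof. by move=> fb X; rewrite (big_pred1 tt) ?tr_reindex // => -[]. Qed.

Definition relabel_instrument (A B : finType) (f : B -> A) (fb : bijective f) :
    instrument R A B unit :=
  Instrument (branch := fun _ => @reindex R B A f : {linear op R A -> op R B})
    (fun _ => @reindex_cp A B f) (reindex_tp fb).

Definition relabel (A B A' B' : finType) (f : A' -> A) (g : B' -> B)
    (fb : bijective f) (gb : bijective g) : lopc R A' B' A B :=
  AliceTalks (relabel_instrument fb) (fun _ =>
    BobTalks (relabel_instrument gb) (fun _ => Done R A' B')).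

Lemma runsum_relabel (V : nmodType) (A B A' B' E : finType) (f : A' -> A) (g : B' -> B)
    (fb : bijective f) (gb : bijective g) (X : op R (A * B * E))
    (G : op R (A' * B' * E) -> V) :
  runsum (relabel fb gb) X G = G (reindex (fun x => (f x.1.1, g x.1.2, x.2)) X).
Proof.
rewrite /relabel runsum_Alice (big_pred1 tt) => [|[]] //.
rewrite runsum_Bob (big_pred1 tt) => [|[]] //; rewrite runsum_Done; congr (G _).
by apply: opP => x y; rewrite ent_onB !ent_reindex ent_mkop ent_onA ent_reindex ent_mkop.
Qed.

(** F (x) id_S with the spectator on the right, the counterpart of [idtens]. *)
Definition lift_map (S A A' : finType) (F : op R A -> op R A') (X : op R (A * S)) :
    op R (A' * S) :=
  mkop (fun x y => ent (F (mkop (fun a a' => ent X (a, x.2) (a', y.2)))) x.1 y.1).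

Lemma lift_map_linear (S A A' : finType) (F : {linear op R A -> op R A'}) :
  linear (@lift_map S A A' F).
Proof.
move=> c X Y; apply: opP => x y; rewrite ent_add ent_scale !ent_mkop.
rewrite -ent_scale -ent_add -linearP; congr (ent (F _) _ _).
by apply: opP => a a'; rewrite ent_add ent_scale !ent_mkop ent_add ent_scale.
Qed.

HB.instance Definition _ (S A A' : finType) (F : {linear op R A -> op R A'}) :=
  GRing.isLinear.Build C (op R (A * S)) (op R (A' * S)) *:%R (@lift_map S A A' F)
    (lift_map_linear F).

Lemma lift_map_cp (S A A' : finType) (F : {linear op R A -> op R A'}) :
  completely_positive F -> completely_positive (@lift_map S A A' F).
Proof.
move=> hF T X hX.
have -> : idtens (@lift_map S A A' F) X =
    reindex (fun x : T * (A' * S) => ((x.1, x.2.2), x.2.1))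
      (idtens F (reindex (fun x : (T * S) * A => (x.1.1, (x.2, x.1.2))) X)).
  apply: opP => x y; rewrite ent_idtens ent_mkop ent_reindex ent_idtens /=.
  by congr (ent (F _) _ _); apply: opP => a a'; rewrite !ent_mkop.
by apply: psd_reindex; apply: hF; apply: psd_reindex.
Qed.

Lemma lift_tp (S A A' M : finType) (F : instrument R A A' M) X :
  \sum_m \tr (@lift_map S A A' (F m) X) = \tr X.
Proof.
have step m : \tr (@lift_map S A A' (F m) X) =
    \sum_s \tr (F m (mkop (fun a a' => ent X (a, s) (a', s)))).
  under [RHS]eq_bigr => s _ do rewrite trE.
  by rewrite trE exchange_big pair_bigA; apply: eq_bigr => -[a s] _; rewrite ent_mkop.
under eq_bigr => m _ do rewrite step.
rewrite exchange_big /=; under eq_bigr => s _ do rewrite branch_tp trE.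
by rewrite trE exchange_big pair_bigA; apply: eq_bigr => -[a s] _; rewrite ent_mkop.
Qed.

Definition lift_instrument (S A A' M : finType) (F : instrument R A A' M) :
    instrument R (A * S)%type (A' * S)%type M :=
  Instrument (branch := fun m => @lift_map S A A' (F m) : {linear _ -> _})
    (fun m => @lift_map_cp S A A' (F m) (branch_cp F m)) (@lift_tp S A A' M F).

Fixpoint lift_lopc (S T KA KB A B : finType) (P : lopc R KA KB A B) :
    lopc R (KA * S)%type (KB * T)%type (A * S)%type (B * T)%type :=
  match P in lopc _ _ _ A B return lopc R (KA * S)%type (KB * T)%type (A * S)%type (B * T)%type with
  | Done => Done R (KA * S)%type (KB * T)%type
  | AliceTalks _ _ _ _ F next =>
      AliceTalks (lift_instrument S F) (fun m => lift_lopc S T (next m))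
  | BobTalks _ _ _ _ F next =>
      BobTalks (lift_instrument T F) (fun m => lift_lopc S T (next m))
  end.

(* The spectator systems S and T are handed over to the eavesdropper and back. *)
Definition to_eve (A B S T E : Type) (x : A * B * (S * T * E)) : (A * S) * (B * T) * E :=
  ((x.1.1, x.2.1.1), (x.1.2, x.2.1.2), x.2.2).

Definition from_eve (A B S T E : Type) (x : (A * S) * (B * T) * E) : A * B * (S * T * E) :=
  (x.1.1.1, x.1.2.1, (x.1.1.2, x.1.2.2, x.2)).

Lemma runsum_congr (V : nmodType) (E KA KB A B : finType) (P : lopc R KA KB A B)
    (X Y : op R (A * B * E)) (G : op R (KA * KB * E) -> V) :
  X = Y -> runsum P X G = runsum P Y G.
Proof. by move=> ->. Qed.

(** P leaves the spectators alone, so they may as well belong to the eavesdropper; facts about P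
    that hold for every E thus cover its action on part of a larger system. *)
Lemma runsum_lift (V : nmodType) (S T E KA KB A B : finType) (P : lopc R KA KB A B)
    (X : op R ((A * S) * (B * T) * E)) (G : op R ((KA * S) * (KB * T) * E) -> V) :
  runsum (lift_lopc S T P) X G =
  runsum P (reindex (@to_eve A B S T E) X) (fun Y => G (reindex (@from_eve KA KB S T E) Y)).
Proof.
elim: P X => [|A0 A' B0 M F next IH|A0 B0 B' M F next IH] X.
- rewrite !runsum_Done reindex_comp; congr (G _).
  by rewrite reindex_eqid // => -[[[a s] [b t]] e].
- rewrite !runsum_Alice; apply: eq_bigr => m _; rewrite IH; apply: runsum_congr.
  apply: opP => x y; rewrite ent_reindex !ent_onA ent_mkop /=; congr (ent (F m _) _ _).
  by apply: opP => a a'; rewrite !ent_mkop.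
- rewrite !runsum_Bob; apply: eq_bigr => m _; rewrite IH; apply: runsum_congr.
  apply: opP => x y; rewrite ent_reindex !ent_onB ent_mkop /=; congr (ent (F m _) _ _).
  by apply: opP => a a'; rewrite !ent_mkop.
Qed.

Definition conjop (T : finType) (X : op R T) : op R T := map_mx Num.conj X.

Lemma ent_conjop (T : finType) (X : op R T) x y : ent (conjop X) x y = (ent X x y)^*%R.
Proof. by rewrite /ent mxE. Qed.

Lemma conjopK (T : finType) : involutive (@conjop T).
Proof. by move=> X; apply: opP => x y; rewrite !ent_conjop conjCK. Qed.

Lemma conjop_psd (T : finType) (X : op R T) : psd X -> psd (conjop X).
Proof.
move=> /psdP h; apply/psdP => v.
have := h (fun x => (v x)^*%R); rewrite -conjC_ge0; congr (_ <= _).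
rewrite rmorph_sum; apply: eq_bigr => x _; rewrite rmorph_sum; apply: eq_bigr => y _ /=.
by rewrite !rmorphM /= !conjCK ent_conjop.
Qed.

Lemma conjop_tr (T : finType) (X : op R T) : \tr (conjop X) = (\tr X)^*%R.
Proof. by rewrite !trE rmorph_sum; apply: eq_bigr => x _; rewrite ent_conjop. Qed.

Lemma conjopB (T : finType) (X Y : op R T) : conjop (X - Y) = conjop X - conjop Y.
Proof. by apply: opP => x y; rewrite ?(ent_conjop, ent_add, ent_opp) rmorphB. Qed.

(** Conjugating both before and after F restores linearity; this amounts to conjugating the Kraus
    operators of F entrywise. *)
Definition conj_map (A A' : finType) (F : op R A -> op R A') (X : op R A) : op R A' :=
  conjop (F (conjop X)).

Lemma conj_map_linear (A A' : finType) (F : {linear op R A -> op R A'}) :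
  linear (@conj_map A A' F).
Proof.
move=> c X Y; rewrite /conj_map.
have -> : conjop (c *: X + Y) = c^*%R *: conjop X + conjop Y.
  by apply: opP => x y; rewrite ?(ent_conjop, ent_add, ent_scale) rmorphD rmorphM.
rewrite linearP; apply: opP => x y.
by rewrite ?(ent_conjop, ent_add, ent_scale) rmorphD rmorphM /= conjCK.
Qed.

HB.instance Definition _ (A A' : finType) (F : {linear op R A -> op R A'}) :=
  GRing.isLinear.Build C (op R A) (op R A') *:%R (@conj_map A A' F) (conj_map_linear F).

Lemma conj_map_cp (A A' : finType) (F : {linear op R A -> op R A'}) :
  completely_positive F -> completely_positive (@conj_map A A' F).
Proof.
move=> hF T X hX.
suff -> : idtens (@conj_map A A' F) X = conjop (idtens F (conjop X)).
  by apply: conjop_psd; apply: hF; apply: conjop_psd.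
apply: opP => x y; rewrite !(ent_idtens, ent_conjop); congr ((ent (F _) _ _)^*%R).
by apply: opP => a a'; rewrite !(ent_conjop, ent_mkop).
Qed.

Lemma conj_tp (A A' M : finType) (F : instrument R A A' M) X :
  \sum_m \tr (@conj_map A A' (F m) X) = \tr X.
Proof.
under eq_bigr => m _ do rewrite conjop_tr.
by rewrite -rmorph_sum /= branch_tp conjop_tr conjCK.
Qed.

Definition conj_instrument (A A' M : finType) (F : instrument R A A' M) :
    instrument R A A' M :=
  Instrument (branch := fun m => @conj_map A A' (F m) : {linear _ -> _})
    (fun m => @conj_map_cp A A' (F m) (branch_cp F m)) (@conj_tp A A' M F).

Fixpoint conj_lopc (KA KB A B : finType) (P : lopc R KA KB A B) : lopc R KA KB A B :=
  match P in lopc _ _ _ A B return lopc R KA KB A B with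
  | Done => Done R KA KB
  | AliceTalks _ _ _ _ F next =>
      AliceTalks (conj_instrument F) (fun m => conj_lopc (next m))
  | BobTalks _ _ _ _ F next =>
      BobTalks (conj_instrument F) (fun m => conj_lopc (next m))
  end.

Lemma runsum_conj (V : nmodType) (E KA KB A B : finType) (P : lopc R KA KB A B)
    (X : op R (A * B * E)) (G : op R (KA * KB * E) -> V) :
  runsum (conj_lopc P) (conjop X) G = runsum P X (fun Y => G (conjop Y)).
Proof.
elim: P X => [|A0 A' B0 M F next IH|A0 B0 B' M F next IH] X.
- by rewrite !runsum_Done.
- rewrite !runsum_Alice; apply: eq_bigr => m _; rewrite -IH; apply: runsum_congr.
  apply: opP => x y; rewrite !(ent_conjop, ent_onA); congr ((ent (F m _) _ _)^*%R).
  by apply: opP => a a'; rewrite !(ent_conjop, ent_mkop) conjCK.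
- rewrite !runsum_Bob; apply: eq_bigr => m _; rewrite -IH; apply: runsum_congr.
  apply: opP => x y; rewrite !(ent_conjop, ent_onB); congr ((ent (F m _) _ _)^*%R).
  by apply: opP => a a'; rewrite !(ent_conjop, ent_mkop) conjCK.
Qed.

End Combinators.

(** * Distance from an ideal key *)

Section KeyGap.
Variable R : realType.
Local Notation C := R[i].

Lemma ent_ideal l x y : ent (ideal_key R l) x y =
  (2 ^+ l)^-1 * ((x.1 == x.2) && (x == y))%:R.
Proof.
rewrite /ideal_key ent_scale ent_sum; congr (_ * _).
under eq_bigr => k _ do rewrite ent_proj !ketE conjC_nat -natrM mulnb.
case: x => x1 x2 /=; rewrite (bigD1 x1) //= big1 ?addr0 => [|k /negPf kx]; last first.
  by rewrite xpair_eqE eq_sym kx.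
rewrite xpair_eqE eqxx /=.
case: (eqVneq x1 x2) => [->|h] /=; first by rewrite eq_sym.
by [].
Qed.

Lemma ideal_psd l : psd (ideal_key R l).
Proof.
apply: psd_scale; first by rewrite invr_ge0 exprn_ge0 ?ler0n.
by apply: psd_sum => k _; apply: psd_proj.
Qed.

Lemma ideal_tr l : \tr (ideal_key R l) = 1.
Proof.
rewrite /ideal_key mxtraceZ raddf_sum /=.
rewrite (eq_bigr (fun=> 1)) => [|k _]; last first.
  rewrite trE (bigD1 (k, k)) //= big1 ?addr0 => [|x /negPf h].
    by rewrite ent_proj ketE eqxx conjC1 mulr1.
  by rewrite ent_proj ketE h mul0r.
by rewrite sumr_const card_tuple card_bool natrX mulVf // expf_neq0 // pnatr_eq0.
Qed.

Definition decorrelated l (E : finType) (Y : op R (key l * key l * E)) :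
    op R (key l * key l * E) := tens (ideal_key R l) (ptrace1 Y).

Definition key_gap l (E : finType) (Y : op R (key l * key l * E)) : R :=
  trace_norm (Y - decorrelated Y).

Lemma decorrelated_psd l (E : finType) (Y : op R (key l * key l * E)) :
  psd Y -> psd (decorrelated Y).
Proof. by move=> hY; apply: psd_tens; [exact: ideal_psd|exact: psd_ptrace1]. Qed.

Lemma decorrelated_tr l (E : finType) (Y : op R (key l * key l * E)) :
  \tr (decorrelated Y) = \tr Y.
Proof. by rewrite tr_tens ideal_tr mul1r tr_ptrace1. Qed.

Lemma key_gap_herm l (E : finType) (Y : op R (key l * key l * E)) : psd Y ->
  (Y - decorrelated Y) ^t* = Y - decorrelated Y.
Proof. by move=> hY; apply: psd_sub_herm => //; apply: decorrelated_psd. Qed.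

Lemma key_gap_ge0 l (E : finType) (Y : op R (key l * key l * E)) : psd Y -> 0 <= key_gap Y.
Proof. by move=> hY; apply/trace_norm_ge0/key_gap_herm. Qed.

Lemma key_gap_le l (E : finType) (Y : op R (key l * key l * E)) : psd Y ->
  key_gap Y <= 2 * rtr Y.
Proof.
move=> hY; rewrite (le_trans (trace_norm_sub_le _ _)) //; first exact: decorrelated_psd.
by rewrite decorrelated_tr Re_add mulr2n mulrDl !mul1r.
Qed.

(** For positive X this is twice [key_error], in a form to which the [runsum] lemmas apply; X may be
    unnormalised. *)
Definition err l (E A B : finType) (P : lopc R (key l) (key l) A B) (X : op R (A * B * E)) : R :=
  runsum P X (@key_gap l E).

Lemma err_ge0 l (E A B : finType) (P : lopc R (key l) (key l) A B) (X : op R (A * B * E)) :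
  psd X -> 0 <= err P X.
Proof. by move=> hX; apply: runsum_ge0 => // Y; apply: key_gap_ge0. Qed.

Lemma err_le_tr l (E A B : finType) (P : lopc R (key l) (key l) A B) (X : op R (A * B * E)) :
  psd X -> err P X <= 2 * rtr X.
Proof.
move=> hX; rewrite -(runsum_rtr P) /runsum mulr_sumr.
by apply: ler_sum => t _; apply/key_gap_le/run_psd.
Qed.

(** The final state and its ideal counterpart are both block diagonal in the transcript, so the
    trace norm of the difference is a sum over blocks. *)
Lemma key_errorE l (E A B : finType) (P : lopc R (key l) (key l) A B) (X : op R (A * B * E)) :
  psd X -> key_error P X = 2^-1 * err P X.
Proof.
move=> hX; congr (_ * _).
pose D t := run (P := P) X t - decorrelated (run (P := P) X t).
have DC t : (D t) ^t* = D t by apply: key_gap_herm; apply: run_psd.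
pose f (x : (key l * key l) * (E * transcript P)) := ((x.1, x.2.1), x.2.2).
pose g (x : (key l * key l) * E * transcript P) := (x.1.1, (x.1.2, x.2)).
have fK : cancel f g by case=> k [e t].
have gK : cancel g f by case=> [[k e] t].
have -> : final_state P X - tens (ideal_key R l) (ptrace1 (final_state P X)) =
    reindex f (blocks D).
  apply: opP => x y; rewrite ent_add ent_opp ent_reindex !ent_mkop /=.
  case: eqP => [xy|xy]; last first.
    rewrite big1 ?mulr0 ?subrr // => s _; rewrite ent_mkop /=.
    by case: eqP.
  rewrite ent_add ent_opp ent_tens ent_ptrace1; congr (_ - _ * _).
  by apply: eq_bigr => s _; rewrite ent_mkop /= xy eqxx.
have bC : (blocks D) ^t* = blocks D.
  apply: opP => x y; rewrite ent_trC !ent_mkop eq_sym.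
  by case: eqP => [->|]; rewrite ?conjC0 // -ent_trC DC.
rewrite /err /runsum -(trace_norm_blocks DC).
apply/eqP; rewrite eq_le; apply/andP; split.
  by apply: trace_norm_reindex => //; exists g.
have {1}-> : blocks D = reindex g (reindex f (blocks D)).
  by apply: opP => x y; rewrite !ent_reindex !gK.
apply: trace_norm_reindex; first by exists f.
by apply: opP => x y; rewrite ent_trC !ent_reindex -ent_trC bC.
Qed.

Lemma evemap_psd (S E E' F : finType) (h : F -> E' -> E) (X : op R (S * E)) :
  psd X -> psd (evemap (fun _ _ _ => 1) h X).
Proof.
move=> hX; suff -> : evemap (fun _ _ _ => 1) h X =
    \sum_f reindex (fun x => (x.1, h f x.2)) X.
  by apply: psd_sum => f _; apply: psd_reindex.
by apply: opP => x y; rewrite ent_mkop ent_sum; apply: eq_bigr => f _; rewrite ent_reindex mul1r.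
Qed.

Lemma evemapB (S E E' F : finType) (w : F -> E' -> E' -> C) (h : F -> E' -> E)
  (X Y : op R (S * E)) : evemap w h (X - Y) = evemap w h X - evemap w h Y.
Proof.
apply: opP => x y; rewrite ent_add ent_opp !ent_mkop -sumrB.
by apply: eq_bigr => f _; rewrite ent_add ent_opp mulrBr.
Qed.

Lemma evemap_tr (S E E' F : finType) (h : F -> E' -> E) (X : op R (S * E)) :
  bijective (fun x => h x.1 x.2) -> \tr (evemap (fun _ _ _ => 1) h X) = \tr X.
Proof.
move=> hb; rewrite !trE.
rewrite !sum_pair; apply: eq_bigr => s _; rewrite [RHS](bigop.reindex _ (onW_bij _ hb)).
under [LHS]eq_bigr => e _ do rewrite ent_mkop.
by rewrite exchange_big pair_bigA; apply: eq_bigr => -[f e] _; rewrite mul1r.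
Qed.

(** Here [evemap] lets the eavesdropper forget the subsystem F. This commutes with [decorrelated]
    and contracts the trace norm. *)
Lemma key_gap_evemap l (E E' F : finType) (h : F -> E' -> E) (Y : op R (key l * key l * E)) :
  bijective (fun x => h x.1 x.2) -> psd Y ->
  key_gap (evemap (fun _ _ _ => 1) h Y) <= key_gap Y.
Proof.
move=> hb hY; rewrite /key_gap.
have -> : decorrelated (evemap (fun _ _ _ => 1) h Y) =
    evemap (fun _ _ _ => 1) h (decorrelated Y).
  apply: opP => x y; rewrite ent_tens ent_ptrace1 ent_mkop.
  under eq_bigr => s _ do rewrite ent_mkop.
  rewrite exchange_big mulr_sumr; apply: eq_bigr => f _.
  rewrite mul1r ent_tens ent_ptrace1; congr (_ * _).
  by apply: eq_bigr => s _; rewrite mul1r.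
rewrite -evemapB; apply: trace_norm_contract => [|P Q|P|P].
- exact: key_gap_herm.
- exact: evemapB.
- exact: evemap_psd.
- exact: evemap_tr.
Qed.

Lemma err_evemap l (E E' F A B : finType) (P : lopc R (key l) (key l) A B)
  (h : F -> E' -> E) (X : op R (A * B * E)) : bijective (fun x => h x.1 x.2) -> psd X ->
  err P (evemap (fun _ _ _ => 1) h X) <= err P X.
Proof.
move=> hb hX; rewrite /err runsum_evemap.
by apply: runsum_le => // Y hY; apply: key_gap_evemap.
Qed.

Lemma decorrelatedZ l (E : finType) c (Y : op R (key l * key l * E)) :
  decorrelated (c *: Y) = c *: decorrelated Y.
Proof.
apply: opP => x y; rewrite ent_scale !ent_tens !ent_ptrace1.
under eq_bigr => s _ do rewrite ent_scale.
by rewrite -mulr_sumr; ring.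
Qed.

Lemma err_scale l (E A B : finType) (P : lopc R (key l) (key l) A B) c (X : op R (A * B * E)) :
  0 <= c -> psd X -> err P (c *: X) <= complex.Re c * err P X.
Proof.
move=> c0 hX.
(* Scaling is viewed as an [evemap] so that it can be moved through the protocol. *)
have scE (S : finType) (Y : op R (S * E)) :
    c *: Y = evemap (fun (_ : unit) _ _ => c) (fun _ e => e) Y.
  apply: opP => -[x x2] [y y2].
  by rewrite ent_scale ent_mkop (big_pred1 tt) // => -[].
rewrite scE /err runsum_evemap /runsum mulr_sumr.
apply: ler_sum => t _.
rewrite -scE /key_gap decorrelatedZ -scalerBr.
by apply: trace_normZ => //; apply/key_gap_herm/run_psd.
Qed.

End KeyGap.

(** * Running protocols in parallel *)

Section Parallel.
Variable R : realType.
Local Notation C := R[i].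

Section KeySplit.
Variables l1 l2 : nat.

Definition key_left (k : key (l1 + l2)) : key l1 := [tuple tnth k (lshift l2 i) | i < l1].
Definition key_right (k : key (l1 + l2)) : key l2 := [tuple tnth k (rshift l1 i) | i < l2].
Definition key_join (x : key l1 * key l2) : key (l1 + l2) :=
  [tuple match fintype.split i with inl a => tnth x.1 a | inr b => tnth x.2 b end | i < l1 + l2].

Lemma key_joinK : cancel key_join (fun k => (key_left k, key_right k)).
Proof.
case=> k1 k2; congr (_, _); apply: eq_from_tnth => i; rewrite !tnth_mktuple.
  by rewrite (unsplitK (inl i)).
by rewrite (unsplitK (inr i)).
Qed.

Lemma key_splitK : cancel (fun k => (key_left k, key_right k)) key_join.
Proof.
move=> k; apply: eq_from_tnth => i; rewrite !tnth_mktuple.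
by case: fintype.splitP => j ij; rewrite tnth_mktuple; congr tnth; apply: val_inj.
Qed.

Lemma key_split_eq (k k' : key (l1 + l2)) :
  (k == k') = (key_left k == key_left k') && (key_right k == key_right k').
Proof. by rewrite -(can_eq key_splitK) xpair_eqE. Qed.

(** The right half comes first because [par] ends with the second key in front of the first. *)
Lemma key_swap_bij : bijective (fun k => (key_right k, key_left k)).
Proof.
exists (fun x => key_join (x.2, x.1)) => [k|[k2 k1]]; first exact: key_splitK.
by have [-> ->] := key_joinK (k1, k2).
Qed.

Variables (E E1 E2 : finType) (r : E -> E1 * E2).
Hypothesis rb : bijective r.

(** Eve's system is split by a bijection r because in use it is a space of functions on all
    positions, not literally a product. *)
Definition merge_index (x : key (l1 + l2) * key (l1 + l2) * E) :
    (key l1 * key l1 * E1) * (key l2 * key l2 * E2) :=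
  ((key_left x.1.1, key_left x.1.2, (r x.2).1), (key_right x.1.1, key_right x.1.2, (r x.2).2)).

Lemma merge_index_bij : bijective merge_index.
Proof.
have [s rK sK] := rb.
exists (fun y => (key_join (y.1.1.1, y.2.1.1), key_join (y.1.1.2, y.2.1.2), s (y.1.2, y.2.2))).
  by case=> [[k k'] e]; rewrite /= !key_splitK -surjective_pairing rK.
move=> [[[k1 k1'] e1] [[k2 k2'] e2]] /=; rewrite /merge_index /= sK.
by have [-> ->] := key_joinK (k1, k2); have [-> ->] := key_joinK (k1', k2').
Qed.

Definition merge (Y1 : op R (key l1 * key l1 * E1)) (Y2 : op R (key l2 * key l2 * E2)) :
    op R (key (l1 + l2) * key (l1 + l2) * E) := reindex merge_index (tens Y1 Y2).

(** The ideal key of l1 + l2 bits is the product of the two ideal keys, and the partial trace over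
    the keys factorises. *)
Lemma decorrelated_merge Y1 Y2 : decorrelated (merge Y1 Y2) =
  reindex merge_index (tens (decorrelated Y1) (decorrelated Y2)).
Proof.
apply: opP => -[[k k'] e] [[j j'] e2].
rewrite ent_reindex !ent_tens /= !ent_ideal !ent_ptrace1 /=.
have -> : (2 ^+ (l1 + l2))^-1 * ((k == k') && ((k, k') == (j, j')))%:R =
   ((2 ^+ l1)^-1 * ((key_left k == key_left k') &&
     ((key_left k, key_left k') == (key_left j, key_left j')))%:R) *
   ((2 ^+ l2)^-1 * ((key_right k == key_right k') &&
     ((key_right k, key_right k') == (key_right j, key_right j')))%:R) :> C.
  rewrite exprD invfM mulrACA -natrM mulnb; congr (_ * (nat_of_bool _)%:R).
  rewrite !xpair_eqE !key_split_eq.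
  by do 6 case: (_ == _).
rewrite [RHS]mulrACA; congr (_ * _).
rewrite big_distrlr /= pair_bigA /=.
pose g (s : key (l1 + l2) * key (l1 + l2)) :=
  ((key_left s.1, key_left s.2), (key_right s.1, key_right s.2)).
have gb : bijective g.
  exists (fun x => (key_join (x.1.1, x.2.1), key_join (x.1.2, x.2.2))).
    by case=> s s'; rewrite /= !key_splitK.
  case=> [[s1 s1'] [s2 s2']]; rewrite /g /=.
  by have [-> ->] := key_joinK (s1, s2); have [-> ->] := key_joinK (s1', s2').
rewrite [RHS](bigop.reindex _ (onW_bij _ gb)); apply: eq_bigr => s _.
by rewrite ent_reindex ent_tens.
Qed.

(** Telescoping: with D the decorrelated states, Y1 Y2 - D1 D2 = (Y1 - D1) Y2 + D1 (Y2 - D2), and D1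
    has the trace of Y1. *)
Lemma key_gap_merge Y1 Y2 : psd Y1 -> psd Y2 ->
  key_gap (merge Y1 Y2) <= key_gap Y1 * rtr Y2 + rtr Y1 * key_gap Y2.
Proof.
move=> h1 h2; rewrite /key_gap decorrelated_merge -reindexB.
have d1 := decorrelated_psd h1; have d2 := decorrelated_psd h2.
rewrite (le_trans (trace_norm_reindex merge_index_bij _)) //.
  by apply: psd_sub_herm; apply: psd_tens.
have -> : tens Y1 Y2 - tens (decorrelated Y1) (decorrelated Y2) =
    tens (Y1 - decorrelated Y1) Y2 + tens (decorrelated Y1) (Y2 - decorrelated Y2).
  by rewrite tensBl tensBr addrA subrK.
rewrite (le_trans (trace_normD _ _)) //.
- by rewrite tensBl; apply: psd_sub_herm; apply: psd_tens.
- by rewrite tensBr; apply: psd_sub_herm; apply: psd_tens.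
apply: lerD; first by apply: trace_norm_tensl => //; apply: key_gap_herm.
rewrite -[rtr Y1]/(complex.Re (\tr Y1)) -decorrelated_tr.
by apply: trace_norm_tensr => //; apply: key_gap_herm.
Qed.

End KeySplit.

Section Par.
Variables (l1 l2 : nat) (A1 B1 A2 B2 A B : finType).
Variables (P1 : lopc R (key l1) (key l1) A1 B1) (P2 : lopc R (key l2) (key l2) A2 B2).
Variables (fA : A1 * A2 -> A) (fB : B1 * B2 -> B).
Hypotheses (fAb : bijective fA) (fBb : bijective fB).

Lemma swap_bij (S T : Type) : bijective (fun x : S * T => (x.2, x.1)).
Proof. by exists (fun x => (x.2, x.1)) => -[]. Qed.

(** The two protocols run one after the other, the idle block being a spectator; the swap in the
    middle brings the second block to the front, where [lift_lopc] acts. *)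
Definition par : lopc R (key (l1 + l2)) (key (l1 + l2)) A B :=
  seq_lopc (relabel R fAb fBb)
  (seq_lopc (lift_lopc A2 B2 P1)
  (seq_lopc (relabel R (swap_bij A2 (key l1)) (swap_bij B2 (key l1)))
  (seq_lopc (lift_lopc (key l1) (key l1) P2)
    (relabel R (key_swap_bij l1 l2) (key_swap_bij l1 l2))))).

(** The equation says that X is the product of X1 and X2 up to relabelling. Each error is weighted
    by the trace of the other factor. *)
Lemma err_par (E E1 E2 : finType) (r : E -> E1 * E2) (X : op R (A * B * E))
    (X1 : op R (A1 * B1 * E1)) (X2 : op R (A2 * B2 * E2)) : bijective r ->
  psd X1 -> psd X2 ->
  reindex (fun x : (A1 * A2) * (B1 * B2) * E => (fA x.1.1, fB x.1.2, x.2)) X =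
  reindex (fun x : (A1 * A2) * (B1 * B2) * E =>
    ((x.1.1.1, x.1.2.1, (r x.2).1), (x.1.1.2, x.1.2.2, (r x.2).2))) (tens X1 X2) ->
  err par X <= err P1 X1 * rtr X2 + rtr X1 * err P2 X2.
Proof.
move=> rb h1 h2 XE.
have -> : err par X = runsum P1 X1 (fun Y1 => runsum P2 X2 (fun Y2 => key_gap (merge r Y1 Y2))).
  rewrite /err /par runsum_seq runsum_relabel XE runsum_seq runsum_lift reindex_comp.
  (* While P1 runs, the whole of X2 is a state adjoined to Eve's system. *)
  have -> : reindex ((fun x : (A1 * A2) * (B1 * B2) * E =>
      ((x.1.1.1, x.1.2.1, (r x.2).1), (x.1.1.2, x.1.2.2, (r x.2).2))) \o
      (@to_eve A1 B1 A2 B2 E)) (tens X1 X2) =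
      evemap (fun (_ : unit) (e e' : A2 * B2 * E) =>
        ent X2 (e.1, (r e.2).2) (e'.1, (r e'.2).2)) (fun _ e => (r e.2).1) X1.
    apply: opP => -[[a1 b1] [[a2 b2] e]] [[a1' b1'] [[a2' b2'] e']].
    by rewrite ent_reindex ent_tens ent_mkop (big_pred1 tt) => [|[]] //=; rewrite mulrC.
  rewrite runsum_evemap; apply: eq_bigr => t1 _.
  move: (run X1 t1) => Y1.
  rewrite runsum_seq runsum_relabel runsum_seq runsum_lift reindex_comp.
  (* Now the roles are exchanged: P2 runs on X2, and the outcome Y1 of P1 is what Eve's system has
     gained. *)
  have -> : reindex ((fun x : (A2 * key l1) * (B2 * key l1) * E =>
      ((x.1.1.2, x.1.1.1), (x.1.2.2, x.1.2.1), x.2)) \o (@to_eve A2 B2 (key l1) (key l1) E))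
      (reindex (@from_eve (key l1) (key l1) A2 B2 E) (evemap (fun (_ : unit) (e e' : A2 * B2 * E) =>
        ent X2 (e.1, (r e.2).2) (e'.1, (r e'.2).2)) (fun _ e => (r e.2).1) Y1)) =
      evemap (fun (_ : unit) (e e' : key l1 * key l1 * E) =>
        ent Y1 (e.1, (r e.2).1) (e'.1, (r e'.2).1)) (fun _ e => (r e.2).2) X2.
    apply: opP => -[[a2 b2] [[k k'] e]] [[a2' b2'] [[j j'] e']].
    rewrite !ent_reindex !ent_mkop !(big_pred1 tt) => [|[]|[]] //=.
    by rewrite mulrC.
  rewrite runsum_evemap; apply: eq_bigr => t2 _.
  rewrite runsum_relabel; congr key_gap; apply: opP => -[[k k'] e] [[j j'] e'].
  rewrite !ent_reindex ent_mkop (big_pred1 tt) => [|[]] //=.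
  by rewrite ent_tens.
(* The inner sum is bounded for fixed Y1, then summed over the first transcript; both times the
   total trace is preserved by the protocol. *)
apply: le_trans (@runsum_le R _ _ _ _ _ _ _ _ (fun Y1 => key_gap Y1 * rtr X2 + rtr Y1 * err P2 X2) _ _) _.
- exact: h1.
- move=> Y1 hY1.
  apply: le_trans (@runsum_le R _ _ _ _ _ _ _ _ (fun Y2 => key_gap Y1 * rtr Y2 + rtr Y1 * key_gap Y2) _ _) _ => //.
    by move=> Y2 hY2; apply: key_gap_merge.
  by rewrite /runsum big_split /= -!mulr_sumr -(runsum_rtr P2 X2).
by rewrite /runsum big_split /= -!mulr_suml -(runsum_rtr P1 X1).
Qed.

End Par.
End Parallel.

(** * Product states and protocols on selected positions *)

Section Products.
Variable R : realType.
Local Notation C := R[i].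

(** Unlike [copies], the factors may differ: after the measurement the state at position i depends
    on the outcome there. *)
Definition prodop (I A B E : finType) (Y : I -> op R (A * B * E)) :
    op R ({ffun I -> A} * {ffun I -> B} * {ffun I -> E}) :=
  mkop (fun x y : {ffun I -> A} * {ffun I -> B} * {ffun I -> E} =>
    \prod_i ent (Y i) (x.1.1 i, x.1.2 i, x.2 i) (y.1.1 i, y.1.2 i, y.2 i)).

Lemma gram_psd (K T : finType) (g : K -> T -> C) :
  psd (mkop (fun x y => \sum_k (g k x)^*%R * g k y)).
Proof.
apply/psdP => v.
suff -> : qform (mkop (fun x y => \sum_k (g k x)^*%R * g k y)) v =
    \sum_k (\sum_x (g k x) * v x) * (\sum_x (g k x) * v x)^*%R.
  by apply: sumr_ge0 => k _; apply: mul_conjC_ge0.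
rewrite /qform; under eq_bigr => x _ do under eq_bigr => y _ do
  rewrite ent_mkop mulr_sumr mulr_suml.
under eq_bigr => x _ do rewrite exchange_big /=.
rewrite exchange_big; apply: eq_bigr => k _ /=.
rewrite mulrC rmorph_sum mulr_suml; apply: eq_bigr => x _ /=.
by rewrite mulr_sumr; apply: eq_bigr => y _; rewrite rmorphM /=; ring.
Qed.

(** Distributing the product over the Gram sums of the factors gives a Gram sum indexed by families
    of Gram indices. *)
Lemma prodop_psd (I A B E : finType) (Y : I -> op R (A * B * E)) :
  (forall i, psd (Y i)) -> psd (prodop Y).
Proof.
move=> hY; have [g gE] := boolp.choice (fun i => psd_gram_ent (hY i)).
have -> : prodop Y = mkop (fun x y : {ffun I -> A} * {ffun I -> B} * {ffun I -> E} =>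
    \sum_(k : {ffun I -> A * B * E})
    (\prod_i g i (k i) (x.1.1 i, x.1.2 i, x.2 i))^*%R *
    \prod_i g i (k i) (y.1.1 i, y.1.2 i, y.2 i)).
  apply: mkop_ext => x y; under eq_bigr => i _ do rewrite gE.
  rewrite bigA_distr_bigA; apply: eq_bigr => k _.
  by rewrite big_split rmorph_prod.
exact: gram_psd.
Qed.

Lemma prodop_tr (I A B E : finType) (Y : I -> op R (A * B * E)) :
  \tr (prodop Y) = \prod_i \tr (Y i).
Proof.
under [RHS]eq_bigr => i _ do rewrite trE.
rewrite bigA_distr_bigA trE.
pose f (k : {ffun I -> A * B * E}) := ([ffun i => (k i).1.1], [ffun i => (k i).1.2], [ffun i => (k i).2]).
have fb : bijective f.
  exists (fun x : {ffun I -> A} * {ffun I -> B} * {ffun I -> E} =>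
      [ffun i => (x.1.1 i, x.1.2 i, x.2 i)]).
    by move=> k; apply/ffunP => i; rewrite !ffunE; case: (k i) => -[].
  by move=> [[x y] z]; congr (_, _, _); apply/ffunP => i; rewrite !ffunE.
rewrite (bigop.reindex _ (onW_bij _ fb)); apply: eq_bigr => k _.
rewrite ent_mkop; apply: eq_bigr => i _ /=; rewrite !ffunE.
by case: (k i) => -[].
Qed.

Lemma copiesE n (A B E : finType) (X : op R (A * B * E)) :
  copies n X = prodop (fun _ : 'I_n => X).
Proof. by []. Qed.

Lemma copies_psd n (A B E : finType) (X : op R (A * B * E)) : psd X -> psd (copies n X).
Proof. by move=> hX; rewrite copiesE; apply: prodop_psd. Qed.

Section Glue.
Variables (I1 I2 I : finType) (f : I1 + I2 -> I) (g : I -> I1 + I2).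
Hypotheses (fK : cancel f g) (gK : cancel g f).

Definition glue (T : finType) (x : {ffun I1 -> T} * {ffun I2 -> T}) : {ffun I -> T} :=
  [ffun i => match g i with inl a => x.1 a | inr b => x.2 b end].

Definition unglue (T : finType) (x : {ffun I -> T}) : {ffun I1 -> T} * {ffun I2 -> T} :=
  ([ffun a => x (f (inl a))], [ffun b => x (f (inr b))]).

Lemma glueK T : cancel (@glue T) (@unglue T).
Proof. by case=> x y; congr (_, _); apply/ffunP => i; rewrite !ffunE fK. Qed.

Lemma unglueK T : cancel (@unglue T) (@glue T).
Proof.
move=> x; apply/ffunP => i; rewrite !ffunE -[in RHS](gK i).
by case: (g i) => j; rewrite !ffunE.
Qed.

Lemma glue_bij T : bijective (@glue T).
Proof. by exists (@unglue T); [exact: glueK|exact: unglueK]. Qed.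

Lemma err_par_prodop (A B E : finType) l1 l2
    (P1 : lopc R (key l1) (key l1) {ffun I1 -> A} {ffun I1 -> B})
    (P2 : lopc R (key l2) (key l2) {ffun I2 -> A} {ffun I2 -> B})
    (Y : I -> op R (A * B * E)) : (forall i, psd (Y i)) ->
  err (par P1 P2 (glue_bij A) (glue_bij B)) (prodop Y) <=
    err P1 (prodop (Y \o f \o inl)) * rtr (prodop (Y \o f \o inr)) +
    rtr (prodop (Y \o f \o inl)) * err P2 (prodop (Y \o f \o inr)).
Proof.
move=> hY; apply: (@err_par _ _ _ _ _ _ _ _ _ _ _ _ _ _ _ _ _ _ (@unglue E)).
- by exists (@glue E); [exact: unglueK|exact: glueK].
- by apply: prodop_psd => i; apply: hY.
- by apply: prodop_psd => i; apply: hY.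
apply: opP => -[[[x1 x2] [y1 y2]] z] [[[x1' x2'] [y1' y2']] z'].
rewrite !ent_reindex ent_tens !ent_mkop /=.
have fb : bijective f by exists g.
rewrite (bigop.reindex _ (onW_bij _ fb)) big_sumType /=.
by congr (_ * _); apply: eq_bigr => i _; rewrite !ffunE fK.
Qed.

End Glue.

Section Junk.
Variables (l : nat) (A B : finType).

(** The a-th operator maps the basis state a to the all-false key: T is discarded and a fixed key
    prepared. *)
Definition prepare_kraus (T : finType) (_ : unit) (a : T) (k : key l) (u : T) : C :=
  ((u == a) && (k == [tuple false | _ < l]))%:R.

Lemma prepare_tp (T : finType) (u v : T) : \sum_m \sum_a \sum_k
  @prepare_kraus T m a k u * (@prepare_kraus T m a k v)^*%R = (u == v)%:R.
Proof.
rewrite (big_pred1 tt) => [|[]] //; rewrite (bigD1 u) //= [X in _ + X]big1 ?addr0.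
  rewrite (bigD1 [tuple false | _ < l]) //= [X in _ + X]big1 ?addr0.
    by rewrite /prepare_kraus !eqxx !andbT conjC_nat mul1r eq_sym.
  by move=> k /negPf h; rewrite /prepare_kraus h andbF mul0r.
move=> a /negPf h; rewrite big1 // => k _.
by rewrite /prepare_kraus eq_sym h mul0r.
Qed.

(** A filler with output of the required type, used where no useful key is expected or the key is
    empty. *)
Definition junk : lopc R (key l) (key l) A B :=
  AliceTalks (kraus_instrument (@prepare_tp A)) (fun _ =>
    BobTalks (kraus_instrument (@prepare_tp B)) (fun _ => Done R (key l) (key l))).

End Junk.

(** There is only one empty key, so every state on [key 0] equals its decorrelated version. *)
Lemma err_key0 (E A B : finType) (P : lopc R (key 0) (key 0) A B) (X : op R (A * B * E)) :
  err P X = 0.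
Proof.
rewrite /err /runsum big1 // => t _; rewrite /key_gap.
have k0 (k : key 0) : k = [tuple] by apply: tuple0.
have -> : decorrelated (run X t) = run X t.
  apply: opP => -[[k k'] e] [[j j'] e'].
  rewrite ent_tens ent_ideal ent_ptrace1 /= expr0 invr1 mul1r.
  rewrite (k0 k) (k0 k') (k0 j) (k0 j') !eqxx mul1r (big_pred1 ([tuple], [tuple])) //.
  by case=> s s'; rewrite (k0 s) (k0 s') /= eqxx.
rewrite subrr -[X in trace_norm X](subrr (0 : op R (key 0 * key 0 * E))).
apply/eqP; rewrite eq_le trace_norm_ge0 ?andbT; last first.
  by apply: psd_sub_herm; apply: psd0.
rewrite (le_trans (trace_norm_sub_le _ _)) //; try exact: psd0.
by rewrite mxtrace0 addr0.
Qed.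

Lemma sum_codom_bij m (I : finType) (g : 'I_m -> I) : injective g ->
  bijective (fun x : 'I_m + {i : I | i \notin codom g} =>
    match x with inl a => g a | inr b => val b end).
Proof.
move=> ginj; apply: inj_card_bij.
  move=> [a|a] [b|b] //= ab; first by rewrite (ginj _ _ ab).
  - by have := valP b; rewrite /= -ab codom_f.
  - by have := valP a; rewrite /= ab codom_f.
  - by rewrite (val_inj ab).
rewrite card_sum card_ord card_sig -(cardC (mem (codom g))) leq_add //.
by rewrite card_codom // card_ord.
Qed.

(** Induction on js: m j positions labelled j feed P j, all remaining positions go to the protocol
    for the rest of js, and positions left over at the end are discarded by [junk]. With normalised
    factors the bound of [err_par_prodop] becomes a plain sum. *)
Lemma multi_protocol (J A B : finType) (m l : J -> nat)
    (P : forall j, lopc R (key (l j)) (key (l j)) {ffun 'I_(m j) -> A} {ffun 'I_(m j) -> B})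
    (js : seq J) (I : finType) (s : I -> J) :
  uniq js -> (forall j, j \in js -> (m j <= #|[set i | s i == j]|)%N) ->
  exists Q : lopc R (key (sumn (map l js))) (key (sumn (map l js))) {ffun I -> A} {ffun I -> B},
  forall (E : finType) (Y : J -> op R (A * B * E)), (forall j, psd (Y j)) ->
    (forall i, \tr (Y (s i)) = 1) ->
    err Q (prodop (Y \o s)) <= \sum_(j <- js) err (P j) (copies (m j) (Y j)).
Proof.
elim: js I s => [|j js IH] I s.
  by move=> _ _; exists (junk 0 _ _) => E Y hY Y1; rewrite big_nil err_key0.
move=> /= /andP[jjs ujs] hm.
have hj := hm j (mem_head _ _).
(* The first m j positions labelled j, in enumeration order. *)
pose g a := enum_val (widen_ord hj a).
have ginj : injective g.
  by move=> a b /enum_val_inj /(congr1 val) /= ab; apply: val_inj.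
have sg a : s (g a) = j.
  by have := enum_valP (widen_ord hj a); rewrite inE => /eqP.
have [h fK hK] := sum_codom_bij ginj.
pose I' : finType := {i : I | i \notin codom g}.
have [j' j'js|Q hQ] := IH I' (fun i => s (val i)) ujs.
  apply: leq_trans (hm j' _) _; first by rewrite inE j'js orbT.
  rewrite -(card_imset _ (@val_inj _ _ I')).
  apply/subset_leq_card/fintype.subsetP => i; rewrite inE => /eqP si.
  (* A position whose label j' lies in js was not consumed for j, because j itself is not in js. *)
  have ig : i \notin codom g.
    by apply: contraNN jjs => /codomP[a ia]; rewrite -(sg a) -ia si.
  by apply/imsetP; exists (exist _ i ig); rewrite // inE /= si.
exists (par (P j) Q (glue_bij fK hK A) (glue_bij fK hK B)) => E Y hY Y1.
apply: le_trans (@err_par_prodop _ _ _ _ _ fK hK A B E _ _ (P j) Q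
  (fun i => Y (s i)) (fun i => hY (s i))) _.
rewrite big_cons.
have tr1 (K : finType) (u : K -> I) : rtr (prodop (fun k => Y (s (u k)))) = 1.
  by rewrite /rtr prodop_tr big1.
rewrite /comp /= !tr1 mulr1 mul1r.
apply: lerD; last by apply: hQ.
suff -> : (fun x => Y (s (g x))) = (fun _ => Y j) by [].
by apply: funext => a; rewrite sg.
Qed.

End Products.

(** * Measuring every copy *)

Section Chebyshev.
Variables (R : realType) (J : finType) (p : J -> R).
Hypotheses (p_ge0 : forall j, 0 <= p j) (p_sum : \sum_j p j = 1).

Lemma sum_prod_ffun n (F : 'I_n -> J -> R) :
  \sum_(s : {ffun 'I_n -> J}) \prod_i F i (s i) = \prod_i \sum_j F i j.
Proof. by rewrite bigA_distr_bigA. Qed.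

Lemma sum_prod1 n : \sum_(s : {ffun 'I_n -> J}) \prod_i p (s i) = 1.
Proof. by rewrite (sum_prod_ffun (fun _ => p)) big1. Qed.

Let z (j t : J) : R := (t == j)%:R - p j.

Lemma mean_centered j : \sum_t p t * z j t = 0.
Proof.
under eq_bigr => t _ do rewrite mulrBr.
rewrite sumrB -mulr_suml p_sum mul1r (bigD1 j) //= eqxx mulr1 big1 ?addr0 ?subrr //.
by move=> t /negPf ->; rewrite mulr0.
Qed.

Lemma variance_centered j : \sum_t p t * (z j t * z j t) = p j * (1 - p j).
Proof.
have -> : \sum_t p t * (z j t * z j t) = \sum_t (p t * z j t * (t == j)%:R) - p j * \sum_t p t * z j t.
  by rewrite mulr_sumr -sumrB; apply: eq_bigr => t _; rewrite /z; ring.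
rewrite mean_centered mulr0 subr0 (bigD1 j) //= big1 ?addr0.
  by rewrite /z eqxx mulr1.
by move=> t /negPf ->; rewrite mulr0.
Qed.

Lemma cross_moment n j (i k : 'I_n) :
  \sum_(s : {ffun 'I_n -> J}) (\prod_l p (s l)) * (z j (s i) * z j (s k)) =
  if i == k then p j * (1 - p j) else 0.
Proof.
(* Independence: the sum over s factors over positions, with one centred indicator at i and one at
   k. If i = k they meet and give the variance; otherwise a mean, which is 0, splits off. *)
pose F (l : 'I_n) t := p t * ((if l == i then z j t else 1) * (if l == k then z j t else 1)).
have -> : \sum_(s : {ffun 'I_n -> J}) (\prod_l p (s l)) * (z j (s i) * z j (s k)) =
    \prod_l \sum_t F l t.
  rewrite -sum_prod_ffun; apply: eq_bigr => s _; rewrite !big_split /=; congr (_ * (_ * _)).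
    by rewrite -big_mkcond (big_pred1 i).
  by rewrite -big_mkcond (big_pred1 k).
case: eqVneq => [ik|ik].
  rewrite (bigD1 i) //= [X in _ * X]big1 ?mulr1.
    by rewrite -variance_centered; apply: eq_bigr => t _; rewrite /F -ik !eqxx.
  move=> l /negPf li; rewrite -[RHS]p_sum; apply: eq_bigr => t _.
  by rewrite /F -ik li !mulr1.
rewrite (bigD1 i) //= [X in X * _](_ : _ = 0) ?mul0r // -[RHS](mean_centered j).
by apply: eq_bigr => t _; rewrite /F eqxx (negPf ik) mulr1.
Qed.

Lemma count_variance n j :
  \sum_(s : {ffun 'I_n -> J}) (\prod_l p (s l)) * (#|[set i | s i == j]|%:R - n%:R * p j) ^+ 2
  = n%:R * (p j * (1 - p j)).
Proof.
have E (s : {ffun 'I_n -> J}) :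
    #|[set i | s i == j]|%:R - n%:R * p j = \sum_i z j (s i).
  rewrite sumrB sumr_const card_ord -[X in _ = _ - X]mulr_natl; congr (_ - _).
  rewrite -sum1_card natr_sum [LHS]big_mkcond /=. apply: eq_bigr => i _.
  by rewrite inE; case: eqP.
under eq_bigr => s _ do rewrite E expr2 big_distrlr /= mulr_sumr.
rewrite exchange_big /=.
under eq_bigr => i _ do under eq_bigr => s _ do rewrite mulr_sumr.
under eq_bigr => i _ do rewrite exchange_big /=.
under eq_bigr => i _ do under eq_bigr => k _ do rewrite cross_moment.
rewrite (eq_bigr (fun=> p j * (1 - p j))) => [|i _]; last first.
  by rewrite -big_mkcond (big_pred1 i) // => k; rewrite eq_sym.
by rewrite sumr_const card_ord mulr_natl.
Qed.

(** On this event the squared deviation exceeds (n p_j - m)^2, while the variance n p_j (1 - p_j) is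
    at most n. *)
Lemma chebyshev_count n j (m : nat) : m%:R < n%:R * p j ->
  \sum_(s : {ffun 'I_n -> J} | (#|[set i | s i == j]| < m)%N) \prod_l p (s l) <=
  n%:R / (n%:R * p j - m%:R) ^+ 2.
Proof.
move=> mn; have d0 : 0 < n%:R * p j - m%:R by rewrite subr_gt0.
rewrite ler_pdivlMr ?exprn_gt0 //.
have pj1 : p j <= 1.
  by rewrite -p_sum (bigD1 j) //= lerDl sumr_ge0.
apply: (@le_trans _ _ (n%:R * (p j * (1 - p j)))); last first.
  by rewrite ler_piMr // mulr_ile1 // ?subr_ge0 // lerBlDr lerDl.
rewrite -count_variance mulr_suml big_mkcond /=; apply: ler_sum => s _.
have P0 : 0 <= \prod_l p (s l) by apply: prodr_ge0.
case: ifP => [sm|_]; last by rewrite mulr_ge0 // sqr_ge0.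
rewrite ler_wpM2l // -[X in _ <= X]sqrrN opprB.
rewrite ler_sqr ?nnegrE ?(ltW d0) ?lerB ?ler_nat ?(ltnW sm) //.
by rewrite subr_ge0 (le_trans _ (ltW mn)) // ler_nat ltnW.
Qed.

End Chebyshev.

(** * Measuring n copies and using the announced outcomes *)

Section OneShot.
Variable R : realType.
Local Notation C := R[i].
Variables (J K A B B' : finType) (V : J -> K -> B' -> B -> C).
Hypothesis Vtp : forall u v, \sum_j \sum_k \sum_x V j k x u * (V j k x v)^*%R = (u == v)%:R.

Definition tensor_kraus n (s : {ffun 'I_n -> J}) (k : {ffun 'I_n -> K})
    (x : {ffun 'I_n -> B'}) (u : {ffun 'I_n -> B}) : C :=
  \prod_i V (s i) (k i) (x i) (u i).

Lemma tensor_kraus_tp n (u v : {ffun 'I_n -> B}) :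
  \sum_s \sum_k \sum_x tensor_kraus s k x u * (tensor_kraus s k x v)^*%R = (u == v)%:R.
Proof.
transitivity (\prod_(i < n) \sum_j \sum_k \sum_x V j k x (u i) * (V j k x (v i))^*%R).
  rewrite bigA_distr_bigA; apply: eq_bigr => s _.
  rewrite bigA_distr_bigA; apply: eq_bigr => k _.
  rewrite bigA_distr_bigA; apply: eq_bigr => x _.
  by rewrite big_split rmorph_prod.
under eq_bigr => i _ do rewrite Vtp.
case: eqP => [->|uv]; first by rewrite big1 // => i _; rewrite eqxx.
have [i ui] : exists i, u i != v i.
  apply/existsP; rewrite -[X in is_true X]negbK negb_exists.
  by apply/negP => /forallP h; apply: uv; apply/ffunP => i; apply/eqP; rewrite -[_ == _]negbK.
by rewrite (bigD1 i) //= (negPf ui) mul0r.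
Qed.

Lemma onB_tensor_kraus n (E : finType) (X : op R (A * B * E)) (s : {ffun 'I_n -> J}) :
  onB (kraus_map (tensor_kraus s)) (copies n X) =
  prodop (fun i => onB (kraus_map (V (s i))) X).
Proof.
apply: opP => -[[a x] e] [[a' y] e']; rewrite ent_onB !ent_mkop /=.
under [RHS]eq_bigr => i _ do rewrite ent_onB ent_mkop /=.
rewrite bigA_distr_bigA; apply: eq_bigr => k _.
rewrite bigA_distr_bigA; apply: eq_bigr => u _.
rewrite bigA_distr_bigA; apply: eq_bigr => v _.
rewrite !ent_mkop /tensor_kraus rmorph_prod -!big_split /=; apply: eq_bigr => i _.
by rewrite ent_mkop.
Qed.

Definition outcome_state (E : finType) (X : op R (A * B * E)) (j : J) : op R (A * B' * E) :=
  onB (kraus_map (V j)) X.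

Definition bad_outcomes n (m : J -> nat) (js : seq J) (s : {ffun 'I_n -> J}) : bool :=
  ~~ all (fun j => m j <= #|[set i | s i == j]|)%N js.

(** For each string s the protocol of [multi_protocol] is used if s has enough of each outcome, and
    [junk] of the same key length otherwise, where the error is at most twice the probability of
    s. *)
Lemma measured_protocol n (m l : J -> nat)
    (P : forall j, lopc R (key (l j)) (key (l j)) {ffun 'I_(m j) -> A} {ffun 'I_(m j) -> B'})
    (js : seq J) : uniq js ->
  exists Q : lopc R (key (sumn (map l js))) (key (sumn (map l js)))
    {ffun 'I_n -> A} {ffun 'I_n -> B},
  forall (E : finType) (X : op R (A * B * E)) (p : J -> R), psd X -> \sum_j p j = 1 ->
    (forall j, \tr (outcome_state X j) = (p j)%:C%C) ->
    err Q (copies n X) <=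
      \sum_(j <- js) err (P j) (copies (m j) ((p j)^-1%:C%C *: outcome_state X j)) +
      2 * \sum_(s : {ffun 'I_n -> J} | bad_outcomes m js s) \prod_i p (s i).
Proof.
move=> ujs.
have ex (s : {ffun 'I_n -> J}) :
    exists Q : lopc R (key (sumn (map l js))) (key (sumn (map l js)))
      {ffun 'I_n -> A} {ffun 'I_n -> B'},
    ~~ bad_outcomes m js s ->
    forall (E : finType) (Y : J -> op R (A * B' * E)), (forall j, psd (Y j)) ->
    (forall i, \tr (Y (s i)) = 1) ->
    err Q (prodop (Y \o s)) <= \sum_(j <- js) err (P j) (copies (m j) (Y j)).
  case: (boolP (bad_outcomes m js s)) => [_|]; first by exists (junk R _ _ _).
  rewrite negbK => /allP hs.
  by have [Q hQ] := multi_protocol P ujs hs; exists Q => _.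
have [Q hQ] := boolp.choice ex.
exists (BobTalks (kraus_instrument (@tensor_kraus_tp n)) Q) => E X p hX p1 pE.
pose Y := outcome_state X.
have hY j : psd (Y j) by apply: onB_psd hX; apply: kraus_map_cp.
have p0 j : 0 <= p j by rewrite -ler0c -pE psd_tr_ge0.
pose eps := \sum_(j <- js) err (P j) (copies (m j) ((p j)^-1%:C%C *: Y j)).
(* If p j = 0, the inverse is 0 by convention and the scaled operator is 0, which is still
   positive. *)
have hZ j : psd ((p j)^-1%:C%C *: Y j) by apply: psd_scale => //; rewrite ler0c invr_ge0.
have eps0 : 0 <= eps.
  by apply: sumr_ge0 => j _; apply: err_ge0; rewrite copiesE; apply: prodop_psd.
rewrite {1}/err runsum_Bob.
have -> : eps + 2 * \sum_(s : {ffun 'I_n -> J} | bad_outcomes m js s) \prod_i p (s i) =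
    \sum_(s : {ffun 'I_n -> J}) ((\prod_i p (s i)) * eps +
      (if bad_outcomes m js s then 2 * \prod_i p (s i) else 0)).
  by rewrite big_split -mulr_suml (sum_prod1 p1) mul1r -big_mkcond mulr_sumr.
apply: ler_sum => s _.
rewrite [X in runsum _ X](_ : _ = prodop (fun i => Y (s i))); last exact: onB_tensor_kraus.
rewrite -/(err (Q s) _).
have psdY : psd (prodop (fun i => Y (s i))) by apply: prodop_psd.
have trY : rtr (prodop (fun i => Y (s i))) = \prod_i p (s i).
  rewrite /rtr prodop_tr; under eq_bigr => i _ do rewrite pE.
  by rewrite -(rmorph_prod (real_complex R)).
have errY := err_le_tr (Q s) psdY; rewrite trY in errY.
have prod0 : 0 <= \prod_i p (s i) by apply: prodr_ge0.
case: (boolP (bad_outcomes m js s)) => [_|gs].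
  by rewrite (le_trans errY) // lerDr mulr_ge0.
rewrite addr0.
(* A string containing an outcome of probability 0 cannot be normalised, but its error is at most
   twice its probability, which is 0. *)
case: (boolP [exists i, p (s i) == 0]) => [/existsP[i /eqP pi0]|].
  have z : \prod_i p (s i) = 0 by rewrite (bigD1 i) //= pi0 mul0r.
  by move: errY; rewrite z mulr0 mul0r.
rewrite negb_exists => /forallP hp.
(* The probability of s is pulled out, leaving a product of normalised states. *)
have -> : prodop (fun i => Y (s i)) = (\prod_i p (s i))%:C%C *:
    prodop ((fun j => (p j)^-1%:C%C *: Y j) \o s).
  apply: opP => x y; rewrite ent_scale !ent_mkop (rmorph_prod (real_complex R)) -big_split /=.
  apply: eq_bigr => i _; rewrite ent_scale mulrA -(rmorphM (real_complex R)).
  by rewrite divff // mul1r.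
apply: le_trans (err_scale _ _ _) _; [by rewrite ler0c|by apply: prodop_psd => i; apply: hZ|].
rewrite ler_wpM2l //; apply: (hQ s gs) => // i.
rewrite mxtraceZ pE -(rmorphM (real_complex R)) mulVf //.
Qed.

End OneShot.

(** * Asymptotic rates *)

Local Open Scope classical_set_scope.

Section Limits.
Variable R : realType.

Lemma inv_nat_cvg0 : (fun n => (n%:R : R)^-1) @ \oo --> (0 : R).
Proof.
apply/cvgrPdist_le => e e0; near=> n.
have n0 : 0 < n%:R :> R by rewrite ltr0n; near: n; exact: nbhs_infty_gt.
rewrite sub0r normrN gtr0_norm ?invr_gt0 // invf_ple ?posrE //.
by near: n; exact: nbhs_infty_ger.
Unshelve. all: by end_near. Qed.

Lemma truncn_scaled_cvgy (c : R) : 0 < c ->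
  (fun n => Num.truncn (c * n%:R)) @ \oo --> \oo.
Proof.
move=> c0; apply/cvgnyPge => m; near=> n.
rewrite truncn_ge_nat; last by rewrite mulr_ge0 // ltW.
rewrite mulrC -ler_pdivrMr //; near: n; exact: nbhs_infty_ger.
Unshelve. all: by end_near. Qed.

Lemma truncn_scaled_ratio (c : R) : 0 <= c ->
  (fun n => (Num.truncn (c * n%:R))%:R / n%:R) @ \oo --> c.
Proof.
move=> c0; apply/cvgrPdist_le => e e0; near=> n.
have n0 : 0 < n%:R :> R by rewrite ltr0n; near: n; exact: nbhs_infty_gt.
have /andP[h1 h2] : (Num.truncn (c * n%:R))%:R <= c * n%:R < (Num.truncn (c * n%:R)).+1%:R.
  by apply: truncn_itv; rewrite mulr_ge0 // ltW.
have h3 : n%:R^-1 <= e.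
  by rewrite invf_ple ?posrE //; near: n; exact: nbhs_infty_ger.
rewrite ger0_norm; last by rewrite subr_ge0 ler_pdivrMr.
apply: le_trans h3; rewrite -[X in _ <= X]mul1r lerBlDr -mulrDl ler_pdivlMr //.
by rewrite ltW // (lt_le_trans h2) // -natr1 addrC.
Unshelve. all: by end_near. Qed.

(** With m = floor(c n), the quotient l(m)/n is m/n times l(m)/m. *)
Lemma rate_cvg (l : nat -> nat) (c r : R) : 0 < c ->
  (fun n => (l n)%:R / n%:R : R) @ \oo --> r ->
  (fun n => (l (Num.truncn (c * n%:R)))%:R / n%:R : R) @ \oo --> c * r.
Proof.
move=> c0 lr.
have h := cvg_comp _ _ (truncn_scaled_cvgy c0) lr.
have h2 := cvgM (truncn_scaled_ratio (ltW c0)) h; refine (cvg_trans _ (h2 _)). apply: near_eq_cvg.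
have hy := truncn_scaled_cvgy c0; move/cvgnyPgt : hy => /(_ 0%N) hy.
near=> n; have m0 : (0 < Num.truncn (c * n%:R))%N by near: n.
by rewrite /= [LHS]mulrC mulrA divfK // pnatr_eq0 -lt0n.
Unshelve. all: by end_near. Qed.

Lemma cvg_sum_seq (J : eqType) (js : seq J) (u : J -> nat -> R) (v : J -> R) :
  (forall j, j \in js -> u j @ \oo --> v j) ->
  (fun n => \sum_(j <- js) u j n) @ \oo --> \sum_(j <- js) v j.
Proof.
elim: js => [|j js IH] h.
  by rewrite big_nil; under eq_fun => n do rewrite big_nil; exact: cvg_cst.
rewrite big_cons; under eq_fun => n do rewrite big_cons.
apply: cvgD; first by apply: h; rewrite mem_head.
by apply: IH => j' h'; apply: h; rewrite inE h' orbT.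
Qed.

Lemma squeeze0 (u v : nat -> R) : (forall n, 0 <= u n) ->
  (\forall n \near \oo, u n <= v n) -> v @ \oo --> (0 : R) -> u @ \oo --> (0 : R).
Proof.
move=> u0 uv v0; apply: (squeeze_cvgr (f := fun=> 0) (h := v)) => //; last exact: cvg_cst.
by near=> n; rewrite u0 /=; near: n.
Unshelve. all: by end_near. Qed.

End Limits.

(** * Achievable rates through measurement *)

Section Measured.
Variable R : realType.
Local Notation C := R[i].

Lemma ptrace2_onB (A B B' E : finType) (F : {linear op R B -> op R B'}) (X : op R (A * B * E)) :
  ptrace2 (onB F X) = idtens F (ptrace2 X).
Proof.
apply: opP => -[a b] [a' b']; rewrite ent_ptrace2 ent_idtens /=.
have -> : mkop (fun u v => ent (ptrace2 X) (a, u) (a', v)) = \sum_e slice_onB X a a' e e.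
  apply: opP => u v; rewrite ent_mkop ent_ptrace2 ent_sum; apply: eq_bigr => e _.
  by rewrite ent_mkop.
by rewrite linear_sum ent_sum; apply: eq_bigr => e _; rewrite ent_onB.
Qed.

Lemma idtens_tp (T A A' M : finType) (F : instrument R A A' M) (X : op R (T * A)) :
  \sum_m \tr (idtens (F m) X) = \tr X.
Proof.
have step m : \tr (idtens (F m) X) =
    \sum_s \tr (F m (mkop (fun a a' => ent X (s, a) (s, a')))).
  rewrite trE sum_pair; apply: eq_bigr => s _; rewrite trE; apply: eq_bigr => a _.
  by rewrite ent_idtens.
under eq_bigr => m _ do rewrite step.
rewrite exchange_big trE sum_pair; apply: eq_bigr => s _ /=.
by rewrite branch_tp trE; apply: eq_bigr => a _; rewrite ent_mkop.
Qed.

Lemma ptrace2_evemap (S E E' F : finType) (h : F -> E' -> E) (X : op R (S * E)) :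
  bijective (fun x => h x.1 x.2) ->
  ptrace2 (evemap (fun _ _ _ => 1) h X) = ptrace2 X.
Proof.
move=> hb; apply: opP => x y; rewrite !ent_ptrace2.
rewrite [RHS](bigop.reindex _ (onW_bij _ hb)).
under [LHS]eq_bigr => e _ do rewrite ent_mkop.
by rewrite exchange_big pair_bigA; apply: eq_bigr => -[f e] _; rewrite mul1r.
Qed.

Lemma copies_evemap n (A B E E' F : finType) (h : F -> E' -> E) (X : op R (A * B * E)) :
  copies n (evemap (fun _ _ _ => 1) h X) =
  evemap (fun _ _ _ => 1)
    (fun (k : {ffun 'I_n -> F}) (e : {ffun 'I_n -> E'}) => [ffun i => h (k i) (e i)])
    (copies n X).
Proof.
apply: opP => -[[x y] z] [[x' y'] z']; rewrite !ent_mkop /=.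
under eq_bigr => i _ do rewrite ent_mkop /=.
rewrite bigA_distr_bigA; apply: eq_bigr => k _.
rewrite mul1r ent_mkop; apply: eq_bigr => i _ /=.
by rewrite mul1r !ffunE.
Qed.

Lemma bij_pointwise n (E E' F : finType) (h : F -> E' -> E) :
  bijective (fun x => h x.1 x.2) ->
  bijective (fun x : {ffun 'I_n -> F} * {ffun 'I_n -> E'} => [ffun i => h (x.1 i) (x.2 i)]).
Proof.
move=> [g hK gK]; exists (fun e : {ffun 'I_n -> E} => ([ffun i => (g (e i)).1], [ffun i => (g (e i)).2])).
  move=> [k e]; congr (_, _); apply/ffunP => i; rewrite !ffunE /=;
  by have -> := hK (k i, e i).
by move=> e; apply/ffunP => i; rewrite !ffunE /=; apply: gK.
Qed.

Variables (J K A B B' : finType) (V : J -> K -> B' -> B -> C).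
Hypothesis Vtp : forall u v, \sum_j \sum_k \sum_x V j k x u * (V j k x v)^*%R = (u == v)%:R.

(** The Kraus index is kept as a register K and handed to the eavesdropper, which keeps the state
    after outcome j pure. *)
Definition kraus_vec (E : finType) (psi : vec R (A * B * E)) (j : J) : vec R (A * B' * (E * K)) :=
  \col_i let x := enum_val i in
    \sum_b V j x.2.2 x.1.2 b * psi (enum_rank (x.1.1, b, x.2.1)) 0.

(** The actual state is the pure one with K discarded. Achievability speaks of pure states only, and
    by [err_evemap] discarding K cannot increase the error. *)
Lemma outcome_state_kraus_vec (E : finType) (psi : vec R (A * B * E)) j :
  outcome_state V (proj psi) j =
  evemap (fun _ _ _ => 1) (fun k e => (e, k)) (proj (kraus_vec psi j)).
Proof.
apply: opP => -[[a b] e] [[a' b'] e']; rewrite ent_onB !ent_mkop /=.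
apply: eq_bigr => k _; rewrite mul1r ent_proj !mxE !enum_rankK /=.
rewrite rmorph_sum big_distrlr /=; apply: eq_bigr => u _; apply: eq_bigr => v _.
by rewrite ent_mkop ent_proj rmorphM /=; ring.
Qed.

Lemma proj_scale (T : finType) c (v : vec R T) : proj (c *: v) = (c * c^*%R) *: proj v.
Proof.
by apply: opP => x y; rewrite ent_scale !ent_proj !mxE rmorphM /=; ring.
Qed.

Lemma evemapZ (S E E' F : finType) (w : F -> E' -> E' -> C) (h : F -> E' -> E) c
  (X : op R (S * E)) : evemap w h (c *: X) = c *: evemap w h X.
Proof.
apply: opP => x y; rewrite ent_scale !ent_mkop mulr_sumr.
by apply: eq_bigr => f _; rewrite ent_scale; ring.
Qed.

Definition post_state (sigma : op R (A * B)) (j : J) : op R (A * B') :=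
  idtens (kraus_map (V j)) sigma.

Lemma post_state_purified (E : finType) (psi : vec R (A * B * E)) sigma j :
  purifies psi sigma -> ptrace2 (outcome_state V (proj psi) j) = post_state sigma j.
Proof. by move=> <-; apply: ptrace2_onB. Qed.

Lemma outcome_state_tr (E : finType) (psi : vec R (A * B * E)) sigma j :
  purifies psi sigma -> \tr (outcome_state V (proj psi) j) = \tr (post_state sigma j).
Proof. by move=> h; rewrite -[LHS]tr_ptrace2 (post_state_purified j h). Qed.

(** The union bound over js. *)
Lemma bad_outcomes_le n (m : J -> nat) (js : seq J) (w : {ffun 'I_n -> J} -> R) :
  (forall s, 0 <= w s) ->
  \sum_(s : {ffun 'I_n -> J} | bad_outcomes m js s) w s <=
  \sum_(j <- js) \sum_(s : {ffun 'I_n -> J} | (#|[set i | s i == j]%SET| < m j)%N) w s.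
Proof.
move=> w0; under [X in _ <= X]eq_bigr => j _ do rewrite big_mkcond.
rewrite exchange_big big_mkcond /=; apply: ler_sum => s _.
case: ifP => [|_]; last by apply: sumr_ge0 => j _; case: ifP.
rewrite /bad_outcomes -has_predC => /hasP[j js_j /=]; rewrite -ltnNge => h.
rewrite (big_rem j) //= h lerDl; apply: sumr_ge0 => j' _; by case: ifP.
Qed.

Lemma achievable_measured (sigma : op R (A * B)) (p r : J -> R) (lam : R) :
  psd sigma -> \tr sigma = 1 -> 0 < lam -> lam < 1 ->
  (forall j, \tr (post_state sigma j) = (p j)%:C%C) ->
  (forall j, p j != 0 -> achievable ((\tr (post_state sigma j))^-1 *: post_state sigma j) (r j)) ->
  achievable sigma (\sum_(j <- enum J | p j != 0) lam * p j * r j).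
Proof.
move=> hs ts lam0 lam1 pE hr.
have p0 j : 0 <= p j.
  by rewrite -ler0c -pE psd_tr_ge0 //; apply: kraus_map_cp.
have p1 : \sum_j p j = 1.
  apply: (@complexI R); rewrite rmorph_sum /= -[RHS]ts -(idtens_tp (kraus_instrument Vtp) sigma).
  by apply: eq_bigr => j _; rewrite -pE.
pose js := [seq j <- enum J | p j != 0].
have ujs : uniq js by rewrite filter_uniq ?enum_uniq.
have jsP j : j \in js = (p j != 0) by rewrite mem_filter mem_enum andbT.
have ex j : exists d : {l : nat -> nat &
    forall n, lopc R (key (l n)) (key (l n)) {ffun 'I_n -> A} {ffun 'I_n -> B'}},
    p j != 0 ->
    (fun n => (projT1 d n)%:R / n%:R : R) @ \oo --> r j /\
    forall (E : finType) (psi : vec R (A * B' * E)),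
      purifies psi ((\tr (post_state sigma j))^-1 *: post_state sigma j) ->
      (fun n => key_error (projT2 d n) (copies n (proj psi))) @ \oo --> (0 : R).
  case: (eqVneq (p j) 0) => [_|pj].
    by exists (existT _ (fun=> 0%N) (fun n => junk R 0 _ _)).
  by have [l [P [h1 h2]]] := hr j pj; exists (existT _ l P).
have [d hd] := boolp.choice ex.
pose m n j := Num.truncn (lam * p j * n%:R).
pose l n j := projT1 (d j) (m n j).
have exQ n := measured_protocol Vtp n (fun j => projT2 (d j) (m n j)) ujs.
(* Q n is fixed here, before any purification appears. *)
pose Q n := sval (cid (exQ n)); have hQ n := svalP (cid (exQ n)).
exists (fun n => sumn (map (l n) js)), Q; split.
  rewrite -[X in _ --> X]big_filter -/js.
  have -> : (fun n => (sumn (map (l n) js))%:R / n%:R : R) =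
      (fun n => \sum_(j <- js) (l n j)%:R / n%:R).
    by apply: funext => n; rewrite sumnE big_map natr_sum mulr_suml.
  apply: cvg_sum_seq => j; rewrite jsP => pj; apply: rate_cvg; last exact: (hd j pj).1.
  by rewrite mulr_gt0 // lt0r pj p0.
move=> E psi hpsi.
have pO j : \tr (outcome_state V (proj psi) j) = (p j)%:C%C.
  by rewrite (outcome_state_tr j hpsi) pE.
have hpp := psd_proj psi.
(* The normalised vector, which purifies the state after outcome j; the hypothesis on the j-th
   protocol applies to it. *)
pose phi j : vec R (A * B' * (E * K)) := (Num.sqrt (p j))^-1%:C%C *: kraus_vec psi j.
have phiE j : proj (phi j) = (p j)^-1%:C%C *: proj (kraus_vec psi j).
  rewrite proj_scale; congr (_ *: _).
  have -> : ((Num.sqrt (p j))^-1%:C%C)^*%R = (Num.sqrt (p j))^-1%:C%C :> C.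
    by apply/CrealP; rewrite complex_real.
  by rewrite -(rmorphM (real_complex R)) -invfM -expr2 sqr_sqrtr.
have ZE j : (p j)^-1%:C%C *: outcome_state V (proj psi) j =
    evemap (fun _ _ _ => 1) (fun k e => (e, k)) (proj (phi j)).
  by rewrite phiE evemapZ outcome_state_kraus_vec.
have phi_pur j : p j != 0 ->
    purifies (phi j) ((\tr (post_state sigma j))^-1 *: post_state sigma j).
  move=> pj; rewrite /purifies.
  rewrite -(@ptrace2_evemap _ _ _ _ (fun (k : K) (e : E) => (e, k))); last exact: swap_bij.
  rewrite -ZE pE -(post_state_purified j hpsi) -fmorphV.
  apply: opP => x y; rewrite ent_scale !ent_ptrace2 mulr_sumr.
  by apply: eq_bigr => e _; rewrite ent_scale.
(* The factor 1/2 of [key_error] turns the sum of the [err] into a sum of key errors and cancels the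
   2 before the bad probability, which Chebyshev bounds. *)
pose u n := \sum_(j <- js) (key_error (projT2 (d j) (m n j)) (copies (m n j) (proj (phi j))) +
   ((p j * (1 - lam)) ^+ 2)^-1 * n%:R^-1).
apply: (@squeeze0 _ _ u).
- move=> n; rewrite key_errorE; last exact: copies_psd.
  by rewrite mulr_ge0 ?invr_ge0 //; apply/err_ge0/copies_psd.
- near=> n.
  have n0 : 0 < n%:R :> R by rewrite ltr0n; near: n; exact: nbhs_infty_gt.
  rewrite key_errorE; last exact: copies_psd.
  have h := hQ n E (proj psi) p hpp p1 pO.
  rewrite ler_pdivrMl // (le_trans h) // /u big_split mulrDr; apply: lerD.
    rewrite mulr_sumr; apply: ler_sum => j _.
    rewrite key_errorE; last by apply: copies_psd; exact: psd_proj.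
    rewrite mulrA divff ?mul1r // ZE copies_evemap; apply: err_evemap.
      exact: (@bij_pointwise (m n j) _ E K (fun k e => (e, k)) (swap_bij K E)).
    by apply: copies_psd; exact: psd_proj.
  rewrite ler_wpM2l // (le_trans (bad_outcomes_le _ _ _)) //.
    by move=> s; apply: prodr_ge0.
  rewrite big_seq [X in _ <= X]big_seq; apply: ler_sum => j; rewrite jsP => pj.
  have pj0 : 0 < p j by rewrite lt0r pj p0.
  have mle : (m n j)%:R <= lam * p j * n%:R.
    by rewrite truncn_le mulr_ge0 // mulr_ge0 // ltW.
  (* m n j is at most lam p_j n, so the deviation is linear in n and Chebyshev's bound is of order
     1/n. *)
  have gap : n%:R * (p j * (1 - lam)) <= n%:R * p j - (m n j)%:R.
    rewrite lerBrDr -lerBrDl (le_trans mle) // le_eqVlt; apply/orP; left; apply/eqP; ring.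
  have gap0 : 0 < n%:R * (p j * (1 - lam)) by rewrite !mulr_gt0 // subr_gt0.
  have mlt : (m n j)%:R < n%:R * p j by rewrite -subr_gt0 (lt_le_trans gap0).
  apply: (le_trans (chebyshev_count p0 p1 mlt)).
  apply: (@le_trans _ _ (n%:R / (n%:R * (p j * (1 - lam))) ^+ 2)).
    rewrite ler_wpM2l ?ler_pV2 ?inE ?unitfE ?exprn_gt0 ?lt0r_neq0 ?exprn_gt0 ?(lt_le_trans gap0) //.
    by rewrite ler_sqr ?nnegrE ?(ltW gap0) ?(le_trans (ltW gap0)).
  rewrite exprMn invfM mulrA mulrC le_eqVlt; apply/orP; left; apply/eqP; congr (_ * _).
  by rewrite expr2 invfM mulrA divff ?mul1r // gt_eqF.
- have -> : (0 : R) = \sum_(j <- js) 0 by rewrite big1_eq.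
  apply: cvg_sum_seq => j; rewrite jsP => pj.
  have pj0 : 0 < p j by rewrite lt0r pj p0.
  rewrite -[X in _ --> X]addr0; apply: cvgD.
    have h := (hd j pj).2 _ _ (phi_pur j pj).
    exact: (cvg_comp _ _ (truncn_scaled_cvgy (mulr_gt0 lam0 pj0)) h).
  rewrite -[X in _ --> X](mulr0 (((p j * (1 - lam)) ^+ 2)^-1)).
  by apply: cvgM; [exact: cvg_cst|exact: inv_nat_cvg0].
Unshelve. all: by end_near. Qed.

End Measured.

(** * Properties of the key rate *)

Section KeyRate.
Variable R : realType.
Local Notation C := R[i].

Lemma trace_norm_conj (T : finType) (X : op R T) : X ^t* = X ->
  trace_norm (conjop X) <= trace_norm X.
Proof.
move=> /trace_norm_attained[P [Q [hP hQ -> ->]]].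
rewrite conjopB; apply: le_trans (trace_norm_sub_le (conjop_psd hP) (conjop_psd hQ)) _.
by rewrite !conjop_tr -rmorphD; case: (_ + _).
Qed.

Lemma decorrelated_conj l (E : finType) (Y : op R (key l * key l * E)) :
  decorrelated (conjop Y) = conjop (decorrelated Y).
Proof.
apply: opP => x y; rewrite ent_conjop !ent_tens !ent_ptrace1 rmorphM rmorph_sum /=.
congr (_ * _); last by apply: eq_bigr => s _; rewrite ent_conjop.
by rewrite !ent_ideal rmorphM /= conjC_nat fmorphV rmorphXn /= conjC_nat.
Qed.

Lemma err_conj l (E A B : finType) (P : lopc R (key l) (key l) A B) (X : op R (A * B * E)) :
  psd X -> err (conj_lopc P) (conjop X) <= err P X.
Proof.
move=> hX; rewrite /err runsum_conj; apply: runsum_le => // Y hY.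
by rewrite /key_gap decorrelated_conj -conjopB; apply/trace_norm_conj/key_gap_herm.
Qed.

(** The conjugate protocol on a purification of the conjugate state does what the original does on
    the conjugated vector, which purifies sigma. *)
Lemma achievable_conj (A B : finType) (sigma : op R (A * B)) r :
  achievable sigma r -> achievable (conjop sigma) r.
Proof.
move=> [l [P [lr hP]]]; exists l, (fun n => conj_lopc (P n)); split=> // E psi hpsi.
pose psi' : vec R (A * B * E) := \col_i (psi i 0)^*%R.
have pE : proj psi = conjop (proj psi').
  by apply: opP => x y; rewrite ent_conjop !ent_proj !mxE rmorphM /= !conjCK.
have hpsi' : purifies psi' sigma.
  have hpsiE : ptrace2 (proj psi) = conjop sigma := hpsi.
  rewrite /purifies -[RHS]conjopK -hpsiE pE.
  apply: opP => x y; rewrite ent_conjop !ent_ptrace2 rmorph_sum /=.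
  by apply: eq_bigr => e _; rewrite ent_conjop conjCK.
have hpp := psd_proj psi; have hpp' := psd_proj psi'.
apply: (squeeze0 _ _ (hP E psi' hpsi')) => [n|].
  rewrite key_errorE; last exact: copies_psd.
  by rewrite mulr_ge0 ?invr_ge0 //; apply/err_ge0/copies_psd.
apply: nearW => n; rewrite !key_errorE; try exact: copies_psd.
rewrite ler_wpM2l ?invr_ge0 //.
have -> : copies n (proj psi) = conjop (copies n (proj psi')).
  apply: opP => x y; rewrite ent_conjop !ent_mkop rmorph_prod.
  by apply: eq_bigr => i _; rewrite pE ent_conjop.
by apply/err_conj/copies_psd.
Qed.

Lemma distillable_key_conj (A B : finType) (sigma : op R (A * B)) :
  distillable_key (conjop sigma) = distillable_key sigma.
Proof.
congr ereal_sup; congr (EFin @` _); apply/seteqP; split=> r /= h.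
  by rewrite -[sigma]conjopK; apply: achievable_conj.
exact: achievable_conj.
Qed.

Lemma psd_tr_conj (T : finType) (X : op R T) : psd X -> X^T = conjop X.
Proof.
move=> /psd_herm h; apply: opP => x y.
by rewrite ent_tr ent_conjop -ent_trC h.
Qed.

Lemma psd_trmx (T : finType) (X : op R T) : psd X -> psd X^T.
Proof. by move=> h; rewrite psd_tr_conj //; apply: conjop_psd. Qed.

(** For a Hermitian operator transposition is entrywise conjugation, and a positive operator has a
    real trace. *)
Lemma K_tr (A B : finType) (sigma : op R (A * B)) : psd sigma -> K sigma^T = K sigma.
Proof.
move=> h; rewrite /K; have -> : (sigma^T == 0) = (sigma == 0).
  by apply/eqP/eqP => [s0|->]; rewrite ?trmx0 // -[sigma]trmxK s0 trmx0.
case: ifP => // _; rewrite mxtrace_tr; congr (_ * _)%E.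
rewrite -distillable_key_conj; congr distillable_key.
rewrite psd_tr_conj //; apply: opP => x y; rewrite ent_conjop !ent_scale ent_conjop rmorphM /= conjCK.
by congr (_ * _); rewrite fmorphV /= (CrealP _) // ger0_real // psd_tr_ge0.
Qed.

Lemma achievable0 (A B : finType) (sigma : op R (A * B)) : achievable sigma 0.
Proof.
exists (fun=> 0%N), (fun n => junk R 0 _ _); split.
  by under eq_fun => n do rewrite mul0r; exact: cvg_cst.
move=> E psi _; under eq_fun => n.
  rewrite key_errorE; last by apply: copies_psd; exact: psd_proj.
  rewrite err_key0 mulr0; over.
exact: cvg_cst.
Qed.

Lemma achievable_ge0 (A B : finType) (sigma : op R (A * B)) r : achievable sigma r -> 0 <= r.
Proof.
move=> [l [P [lr _]]]; rewrite -(cvg_lim _ lr) //; apply: limr_ge; first by apply: cvgP lr.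
by apply: nearW => n; rewrite divr_ge0.
Qed.

Lemma distillable_key_ge0 (A B : finType) (sigma : op R (A * B)) :
  (0 <= distillable_key sigma)%E.
Proof. by apply: ereal_sup_ubound; exists 0 => //; apply: achievable0. Qed.

(** The case sigma = 0 is absorbed because 0 times any extended real, infinity included, is 0. *)
Lemma KE (A B : finType) (sigma : op R (A * B)) :
  K sigma = ((rtr sigma)%:E * distillable_key ((\tr sigma)^-1 *: sigma))%E.
Proof. by rewrite /K; case: eqP => // ->; rewrite /rtr mxtrace0 mul0e. Qed.

Lemma K_ge0 (A B : finType) (sigma : op R (A * B)) : psd sigma -> (0 <= K sigma)%E.
Proof.
move=> h; rewrite KE mule_ge0 ?distillable_key_ge0 //.
by rewrite lee_fin; apply: rtr_ge0.
Qed.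

Lemma K_normalized (A B : finType) (sigma : op R (A * B)) : \tr sigma = 1 ->
  K sigma = distillable_key sigma.
Proof. by move=> t; rewrite KE /rtr t invr1 scale1r mul1e. Qed.

(** Passes from bounds for individual rates and lam < 1 to a bound for the sum of suprema. For
    finite S, lam is removed first, then each relevant supremum is shown finite, and finally all are
    approximated at once. *)
Lemma weighted_sup_le (J : finType) (p : J -> R) (A : J -> set R) (S : \bar R) :
  (forall j, 0 <= p j) -> (forall j, A j 0) -> (forall j x, A j x -> 0 <= x) ->
  (forall lam r, 0 < lam -> lam < 1 -> (forall j, p j != 0 -> A j (r j)) ->
    ((\sum_(j <- enum J | p j != 0) lam * p j * r j)%:E <= S)%E) ->
  (\sum_j (p j)%:E * ereal_sup (EFin @` A j) <= S)%E.
Proof.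
move=> p0 A0 Age0 h.
have half01 : 0 < 2^-1 :> R /\ 2^-1 < 1 :> R by split; lra.
have hS : (0 <= S)%E.
  have := h _ (fun=> 0) half01.1 half01.2 (fun j _ => A0 j).
  by rewrite big1 // => j _; rewrite mulr0.
case: S h hS => [s| |] h hS; [|by rewrite leey|by []].
have hr r : (forall j, A j (r j)) -> \sum_j p j * r j <= s.
  move=> Ar; set T := \sum_j _.
  have T0 : 0 <= T by apply: sumr_ge0 => j _; rewrite mulr_ge0 //; apply: Age0.
  have hl lam : 0 < lam -> lam < 1 -> lam * T <= s.
    move=> l0 l1; have := h lam r l0 l1 (fun j _ => Ar j); rewrite lee_fin.
    apply: le_trans; rewrite mulr_sumr big_enum_cond /= [X in _ <= X]big_mkcond /=.
    by apply: ler_sum => j _; case: eqVneq => [->|_] /=; rewrite ?mulr0 ?mul0r ?mulr0 // mulrA.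
  rewrite leNgt; apply/negP => sT; rewrite lee_fin in hS.
  have Tp : 0 < T by apply: le_lt_trans sT.
  (* The midpoint of s / T and 1 as lam would give (s + T) / 2 <= s, contradicting s < T. *)
  have l1 : (s / T + 1) / 2 < 1.
    by have : s / T < 1 by [rewrite ltr_pdivrMr // mul1r]; lra.
  have l0 : 0 < (s / T + 1) / 2.
    by have : 0 <= s / T by [rewrite divr_ge0]; lra.
  have := hl _ l0 l1.
  have -> : (s / T + 1) / 2 * T = (s + T) / 2 by field; rewrite gt_eqF.
  lra.
pose D j := ereal_sup (EFin @` A j).
have D0 j : (0 <= D j)%E by apply: ereal_sup_ubound; exists 0.
have Dfin j : p j != 0 -> D j \is a fin_num.
  move=> pj; have pj0 : 0 < p j by rewrite lt0r pj p0.
  rewrite ge0_fin_numE //; apply: (@le_lt_trans _ _ (s / p j)%:E); last exact: ltry.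
  apply: ge_ereal_sup => _ [x Ax <-]; rewrite lee_fin ler_pdivlMr // mulrC.
  (* With rate 0 for all other outcomes the bound reads p j * x <= s. *)
  have := hr (fun k => if k == j then x else 0).
  rewrite (bigD1 j) //= eqxx big1 ?addr0; last first.
    by move=> k /negPf ->; rewrite mulr0.
  by apply => k; case: eqP => [->|].
have -> : (\sum_j (p j)%:E * D j = (\sum_j p j * fine (D j))%:E)%E.
  rewrite -sumEFin; apply: eq_bigr => j _; rewrite EFinM.
  by case: (eqVneq (p j) 0) => [->|pj]; rewrite ?mul0e // fineK // Dfin.
rewrite lee_fin; apply/ler_addgt0Pr => e e0.
pose P := \sum_j p j.
have P0 : 0 <= P by apply: sumr_ge0.
(* The added 1 keeps the denominator positive even if all weights vanish. *)
pose e' := e / (P + 1).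
have e'0 : 0 < e' by rewrite divr_gt0 // ltr_wpDl.
have ex j : exists x, A j x /\ (p j != 0 -> fine (D j) - e' <= x).
  case: (eqVneq (p j) 0) => [_|pj]; first by exists 0.
  have [_ [x Ax <-]] := ub_ereal_sup_adherent e'0 (Dfin j pj).
  rewrite -/(D j) -[D j]fineK ?Dfin // -EFinB lte_fin => /ltW hx.
  by exists x.
have [r hrr] := boolp.choice ex.
apply: (@le_trans _ _ (\sum_j p j * r j + \sum_j p j * e')).
  rewrite -big_split; apply: ler_sum => j _ /=; rewrite -mulrDr.
  case: (eqVneq (p j) 0) => [->|pj]; first by rewrite !mul0r.
  by rewrite ler_wpM2l // -lerBlDr; apply: (hrr j).2.
apply: lerD; first by apply: hr => j; apply: (hrr j).1.
rewrite -mulr_suml -/P /e' mulrA ler_pdivrMr ?ltr_wpDl // mulrC.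
by rewrite ler_wpM2l ?(ltW e0) // lerDl.
Qed.

End KeyRate.

(** * The MDI-QKD protocol *)

Section MDI.
Variable R : realType.
Local Notation C := R[i].

Lemma conj_invsqrt2 : ((sqrtC 2)^-1 : C)^*%R = (sqrtC 2)^-1.
Proof. by apply/CrealP; rewrite rpredV ger0_real // sqrtC_ge0 ler0n. Qed.

Lemma invsqrt2_sq : (sqrtC 2)^-1 * (sqrtC 2)^-1 = 2^-1 :> C.
Proof. by rewrite -invfM -expr2 sqrtCK. Qed.

Lemma ent_Phi_plus x y :
  ent (Phi_plus R) x y = 2^-1 * ((x.1 == x.2) && (y.1 == y.2))%:R.
Proof.
rewrite ent_scale ent_sum; congr (_ * _).
under eq_bigr => j _ do rewrite ent_sum.
under eq_bigr => j _ do under eq_bigr => k _ do rewrite ent_outer !ketE conjC_nat.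
under eq_bigr => j _ do rewrite -mulr_sumr.
rewrite -mulr_suml -mulnb natrM.
have s (z : qubit * qubit) : \sum_(j : qubit) (z == (j, j))%:R = (z.1 == z.2)%:R :> C.
  case: z => z1 z2 /=; rewrite (bigD1 z1) //= big1 ?addr0 => [|j /negPf h].
    by rewrite xpair_eqE eqxx /= eq_sym.
  by rewrite xpair_eqE eq_sym h.
by rewrite !s.
Qed.

Lemma Phi_plus_psd : psd (Phi_plus R).
Proof.
have -> : Phi_plus R = mkop (fun x y => \sum_(k : unit)
    ((sqrtC 2)^-1 * (x.1 == x.2)%:R)^*%R * ((sqrtC 2)^-1 * (y.1 == y.2)%:R)).
  apply: opP => x y; rewrite ent_Phi_plus ent_mkop (big_pred1 tt) => [|[]] //.
  by rewrite rmorphM /= conj_invsqrt2 conjC_nat mulrACA invsqrt2_sq -mulnb natrM.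
exact: gram_psd.
Qed.

Lemma Phi_plus_tr : \tr (Phi_plus R) = 1.
Proof.
rewrite trE; under eq_bigr => x _ do rewrite ent_Phi_plus andbb.
rewrite -mulr_sumr.
have -> : \sum_(x : qubit * qubit) (x.1 == x.2)%:R = \sum_(a : qubit) 1 :> C.
  rewrite sum_pair; apply: eq_bigr => a _; rewrite (bigD1 a) //= big1 ?addr0 ?eqxx // => b /negPf h.
  by rewrite eq_sym h.
by rewrite sumr_const card_ord mulVf // pnatr_eq0.
Qed.

Section Channel.
Variable N : {linear op R qubit -> op R qubit}.
Hypothesis hN : is_channel N.

Lemma choi_psd : psd (choi N).
Proof. by apply: hN.1; apply: Phi_plus_psd. Qed.

Lemma channel_tp (X : op R qubit) : \sum_(m : unit) \tr (N X) = \tr X.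
Proof. by rewrite (big_pred1 tt) ?hN.2 // => -[]. Qed.

Lemma choi_tr : \tr (choi N) = 1.
Proof.
pose F := Instrument (branch := fun _ : unit => N) (fun _ => hN.1) channel_tp.
by rewrite -Phi_plus_tr -(idtens_tp F (Phi_plus R)) (big_pred1 tt) => [|[]].
Qed.

Lemma choi_diag u v : \sum_a ent (choi N) (a, u) (a, v) = 2^-1 * ent (N 1%:M) u v.
Proof.
under eq_bigr => a _ do rewrite ent_idtens /=.
rewrite -ent_sum -linear_sum -ent_scale -linearZ; congr (ent (N _) _ _).
apply: opP => x y; rewrite ent_sum ent_scale ent1.
under eq_bigr => a _ do rewrite ent_mkop ent_Phi_plus /=.
rewrite -mulr_sumr; congr (_ * _).
rewrite (bigD1 x) //= big1 ?addr0 ?eqxx // => a /negPf h.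
by rewrite h.
Qed.

(** The two indicators in [Phi_plus] identify A with A', and its factor 1/2 reduces 4 to 2. The row
    index of the result lands in the column of J and vice versa, which is the origin of the
    transpose. *)
Lemma ent_rho_tilde (J P : op R (qubit * qubit)) x y :
  ent (rho_tilde J P) x y =
  2 * \sum_u \sum_v ent J (y.1, u) (x.1, v) * ent P (v, x.2) (u, y.2).
Proof.
have delta (T : finType) (t : T) (F : T -> C) : \sum_s (s == t)%:R * F s = F t.
  rewrite (bigD1 t) //= eqxx mul1r big1 ?addr0 // => s /negPf ->.
  by rewrite mul0r.
rewrite /rho_tilde ent_scale ent_ptrace2 sum_pair.
have -> : 4 = 2 * 2 :> C by rewrite -natrM.
rewrite -mulrA; congr (_ * _); rewrite mulr_sumr.
transitivity (\sum_a \sum_b \sum_u (x.1 == a)%:R * (ent J (y.1, u) (a, b) * ent P (b, x.2) (u, y.2)) : C).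
  apply: eq_bigr => a _; rewrite mulr_sumr; apply: eq_bigr => b _.
  rewrite ent_reindex ent_mul sum_pair sum_pair /= mulr_sumr.
  under [LHS]eq_bigr => c _ do rewrite mulr_sumr.
  under [LHS]eq_bigr => c _ do under eq_bigr => c' _ do rewrite sum_pair mulr_sumr.
  transitivity (\sum_(c : qubit) \sum_(c' : qubit) (c' == y.1)%:R * \sum_(u : qubit)
     (((x.1 == a)%:R * (c == c')%:R) * (ent J (c, u) (a, b) * ent P (b, x.2) (u, y.2))) : C).
    apply: eq_bigr => c _; apply: eq_bigr => c' _; rewrite mulr_sumr; apply: eq_bigr => d _.
    rewrite -[RHS](delta _ y.2 (fun d' => (c' == y.1)%:R * (((x.1 == a)%:R * (c == c')%:R) *
      (ent J (c, d) (a, b) * ent P (b, x.2) (d, d'))))).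
    rewrite mulr_sumr; apply: eq_bigr => d' _.
    rewrite ent_reindex !ent_tens /= !ent1 ent_Phi_plus /= -mulnb natrM [a == x.1]eq_sym.
    by rewrite -[RHS]mul1r -[X in _ = X * _](divff (_ : 2 != 0 :> C)) ?pnatr_eq0 //; ring.
  under [LHS]eq_bigr => c _ do rewrite delta.
  rewrite exchange_big; apply: eq_bigr => u _ /=.
  rewrite (eq_bigr (fun c => (c == y.1)%:R * ((x.1 == a)%:R *
    (ent J (c, u) (a, b) * ent P (b, x.2) (u, y.2))))); last by move=> c _; ring.
  by rewrite delta.
transitivity (\sum_a (a == x.1)%:R * \sum_b \sum_u
    (ent J (y.1, u) (a, b) * ent P (b, x.2) (u, y.2)) : C).
  apply: eq_bigr => a _; rewrite mulr_sumr; apply: eq_bigr => b _.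
  by rewrite mulr_sumr; apply: eq_bigr => u _; rewrite eq_sym.
by rewrite delta exchange_big.
Qed.

(** The trace over A' leaves only the marginal of J on B, which is N(1)/2 by [choi_diag]. *)
Lemma rho_tilde_tr (P : op R (qubit * qubit)) :
  \tr (rho_tilde (choi N) P) = \tr (P *m tens (N 1%:M) 1%:M).
Proof.
transitivity (\sum_x \sum_u \sum_v ent (N 1%:M) u v * ent P (v, x) (u, x)).
  rewrite trE sum_pair exchange_big; apply: eq_bigr => x _ /=.
  under [LHS]eq_bigr => a _ do rewrite ent_rho_tilde /=.
  rewrite -mulr_sumr exchange_big mulr_sumr; apply: eq_bigr => u _ /=.
  rewrite exchange_big mulr_sumr; apply: eq_bigr => v _ /=.
  by rewrite -mulr_suml choi_diag !mulrA divff ?mul1r // pnatr_eq0.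
rewrite [RHS]trE sum_pair [RHS]exchange_big; apply: eq_bigr => x _ /=.
rewrite exchange_big; apply: eq_bigr => v _ /=.
rewrite ent_mul sum_pair; apply: eq_bigr => u _.
rewrite (bigD1 x) //= [X in _ = _ + X]big1 ?addr0 => [|x' /negPf h].
  by rewrite ent_tens ent1 eqxx /= mulr1 mulrC.
by rewrite ent_tens ent1 /= h !mulr0.
Qed.

Lemma tensDl (S T : finType) (X X' : op R S) (Y : op R T) :
  tens (X + X') Y = tens X Y + tens X' Y.
Proof. by apply: opP => x y; rewrite ent_add !ent_tens ent_add mulrDl. Qed.

Lemma tensDr (S T : finType) (X : op R S) (Y Y' : op R T) :
  tens X (Y + Y') = tens X Y + tens X Y'.
Proof. by apply: opP => x y; rewrite ent_add !ent_tens ent_add mulrDr. Qed.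

(** The four probabilities add up bilinearly to the inputs 1 and 1, so every resolution of the
    identity gives the same total. *)
Lemma prob_sum (P : op R (qubit * qubit)) (v w : vec R qubit) :
  proj v + proj w = 1%:M ->
  prob N P v v + prob N P v w + prob N P w v + prob N P w w = rtr (rho_tilde (choi N) P).
Proof.
move=> vw; have E : tens (N 1%:M) 1%:M = tens (N (proj v)) (proj v) +
    tens (N (proj v)) (proj w) + tens (N (proj w)) (proj v) + tens (N (proj w)) (proj w).
  by rewrite -vw linearD tensDl tensDr tensDr addrA.
by rewrite /rtr rho_tilde_tr E 3!mulmxDr 3!mxtraceD 3!Re_add.
Qed.

End Channel.

Lemma proj_ket01 : proj (ket0 R) + proj (ket1 R) = 1%:M.
Proof.
apply: opP => x y; rewrite ent_add !ent_proj !ketE !conjC_nat ent1.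
by case: x => [[|[|x]] hx] //; case: y => [[|[|y]] hy] //; rewrite -!val_eqE /= ?mulr0 ?mulr1 ?addr0 ?add0r.
Qed.

Lemma proj_ketpm : proj (ketp R) + proj (ketm R) = 1%:M.
Proof.
rewrite /ketp /ketm !proj_scale conj_invsqrt2 invsqrt2_sq -scalerDr -proj_ket01.
apply: opP => x y; rewrite ent_scale !ent_add !ent_proj.
rewrite ![(_ + _ : 'cV_ _) _ _]mxE ![(- _ : 'cV_ _) _ _]mxE !rmorphD !rmorphN /=.
set a := ket0 R _ _; set b := ket1 R _ _; set a' := (ket0 R _ _)^*%R; set b' := (ket1 R _ _)^*%R.
have -> : (a + b) * (a' + b') + (a - b) * (a' - b') = 2 * (a * a' + b * b') by ring.
by rewrite mulrA mulVf ?mul1r // pnatr_eq0.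
Qed.

Section Measurement.
Variable Pi : 'I_4 -> op R (qubit * qubit).
Hypothesis hPi : is_povm Pi.
Variable g : 'I_4 -> qubit * qubit -> qubit * qubit -> C.
Hypothesis gE : forall j x y, ent (Pi j) x y = \sum_k (g j k x)^*%R * g j k y.

(* Bob prepares a maximally entangled pair B'B'', measures Pi on BB'' and keeps B'. *)
Definition bell_kraus (j : 'I_4) (k : qubit * qubit) (x u : qubit) : C :=
  (sqrtC 2)^-1 * g j k (u, x).

Lemma bell_kraus_mul j k k' x y u v : bell_kraus j k x u * (bell_kraus j k' y v)^*%R =
  2^-1 * ((g j k' (v, y))^*%R * g j k (u, x)).
Proof.
by rewrite /bell_kraus rmorphM /= conj_invsqrt2 -invsqrt2_sq; ring.
Qed.

(** Completeness of the POVM gives the indicator of u = v for each of the two values of x; the Bell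
    pair's 1/2 compensates for the two. *)
Lemma bell_kraus_tp u v :
  \sum_j \sum_k \sum_x bell_kraus j k x u * (bell_kraus j k x v)^*%R = (u == v)%:R.
Proof.
under eq_bigr => j _ do under eq_bigr => k _ do under eq_bigr => x _ do rewrite bell_kraus_mul.
under eq_bigr => j _ do rewrite exchange_big /=.
rewrite exchange_big /=.
rewrite (eq_bigr (fun=> 2^-1 * (u == v)%:R)) => [|x _].
  by rewrite sumr_const card_ord -[LHS]mulr_natl mulrA divff ?mul1r // pnatr_eq0.
under eq_bigr => j _ do rewrite -mulr_sumr -gE.
by rewrite -mulr_sumr -ent_sum hPi.2 ent1 xpair_eqE eqxx andbT eq_sym.
Qed.

(** Of the factor 4, one 2 is that of [ent_rho_tilde] and the other cancels the 1/2 of the Bell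
    pair; the Gram sum of [Pi j] is the Kraus sum. *)
Lemma rho_tilde_post_state J j :
  (rho_tilde J (Pi j))^T = 4 *: post_state bell_kraus J j.
Proof.
apply: opP => x y; rewrite ent_tr ent_rho_tilde ent_scale ent_idtens ent_mkop.
have -> : 4 = 2 * 2 :> C by rewrite -natrM.
rewrite -mulrA; congr (_ * _).
rewrite [in RHS]exchange_big mulr_sumr; apply: eq_bigr => u _ /=.
rewrite [in RHS]exchange_big mulr_sumr; apply: eq_bigr => v _ /=.
rewrite gE !mulr_sumr; apply: eq_bigr => k _.
rewrite ent_mkop [in RHS]mulrAC bell_kraus_mul.
by rewrite [in RHS]mulrA [in RHS]mulrA divff ?pnatr_eq0 // mul1r mulrC.
Qed.

End Measurement.
End MDI.

(** * The lower bound on the key rate of the Choi state *)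

Section Bounds.
Variable R : realType.
Variable N : {linear op R qubit -> op R qubit}.
Hypothesis hN : is_channel N.
Variable Pi : 'I_4 -> op R (qubit * qubit).
Hypothesis hPi : is_povm Pi.
Local Notation C := R[i].
Local Notation J := (choi N).
Local Notation rho j := (rho_tilde J (Pi j)).

(** The transpose is four times the image of J under a completely positive map. *)
Lemma rho_tilde_psd j : psd (rho j).
Proof.
have [g gE] := boolp.choice (fun j => psd_gram_ent (hPi.1 j)).
rewrite -[rho j]trmxK (rho_tilde_post_state gE); apply: psd_trmx; apply: psd_scale => //.
by apply: kraus_map_cp; apply: choi_psd.
Qed.

Lemma K_rho_tilde_sum_le : ((4^-1)%R%:E * \sum_j K (rho j) <= K J)%E.
Proof.
have [g gE] := boolp.choice (fun j => psd_gram_ent (hPi.1 j)).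
have Vtp := bell_kraus_tp hPi gE; set V := bell_kraus g in Vtp.
have hJ := choi_psd hN; have tJ := choi_tr hN.
have hpost j : psd (post_state V J j) by apply: kraus_map_cp.
pose p j := rtr (post_state V J j).
(* The factor 1/4 turns the trace of rho j into the probability of outcome j, giving the weighted
   suprema of [weighted_sup_le]. *)
have KrhoE j : ((4^-1)%R%:E * K (rho j) =
    (p j)%:E * distillable_key ((\tr (post_state V J j))^-1 *: post_state V J j))%E.
  rewrite -(K_tr (rho_tilde_psd j)) (rho_tilde_post_state gE) -/V KE.
  have -> : rtr (4 *: post_state V J j) = 4 * p j.
    by rewrite /rtr /p mxtraceZ mulrC Re_mul_ge0 // mulrC; congr (_ * _).
  have q (x : R) : 4^-1 * (4 * x) = x by rewrite mulrA mulVf ?mul1r // pnatr_eq0.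
  rewrite muleA -EFinM q; congr (_ * distillable_key _)%E.
  by rewrite mxtraceZ invfM scalerA mulrAC mulVf ?mul1r // pnatr_eq0.
rewrite ge0_sume_distrr; last by move=> j _; apply/K_ge0/rho_tilde_psd.
under eq_bigr => j _ do rewrite KrhoE.
rewrite (K_normalized tJ).
apply: (weighted_sup_le (A := fun j => [set r | achievable
  ((\tr (post_state V J j))^-1 *: post_state V J j) r]%classic)) => [j|j|j x|lam r l0 l1 hr].
- exact: rtr_ge0 (hpost j).
- exact: achievable0.
- exact: achievable_ge0.
apply: ereal_sup_ubound; eexists; last by [].
apply: (achievable_measured Vtp hJ tJ l0 l1 _ hr) => j.
exact: rtrE (hpost j).
Qed.

End Bounds.

Local Open Scope ereal_scope.

Theorem mainTheorem8 (R : realType)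
    (N : {linear op R qubit -> op R qubit}) (hN : is_channel N)
    (Pi : 'I_4 -> op R (qubit * qubit)) (hPi : is_povm Pi) (a : 'I_4) :
  let J := choi N in
  let rho j := rho_tilde J (Pi j) in
  let p := prob N (Pi a) in
  let Ka := K ((\tr (rho a))^-1 *: (rho a)^T)%R in
  let c : \bar R := (4^-1)%R%:E in
  let ket0 := ket0 R in let ket1 := ket1 R in
  let ketp := ketp R in let ketm := ketm R in
  [/\ K J >= c * \sum_(j : 'I_4) K (rho j),
      c * \sum_(j : 'I_4) K (rho j) >= c * K ((rho a)^T)%R,
      c * K ((rho a)^T)%R =
        c * Ka * (p ket0 ket0 + p ket0 ket1 + p ket1 ket0 + p ket1 ket1)%R%:E &
      c * Ka * (p ket0 ket0 + p ket0 ket1 + p ket1 ket0 + p ket1 ket1)%R%:E =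
        c * Ka * (p ketp ketp + p ketp ketm + p ketm ketp + p ketm ketm)%R%:E].
Proof.
move=> J rho p Ka c k0 k1 kp km.
have hrho j : psd (rho j) := rho_tilde_psd hN hPi j.
have e01 : (p k0 k0 + p k0 k1 + p k1 k0 + p k1 k1 = rtr (rho a))%R.
  exact: prob_sum (proj_ket01 R).
have epm : (p kp kp + p kp km + p km kp + p km km = rtr (rho a))%R.
  exact: prob_sum (proj_ketpm R).
have cK : c * K (rho a)^T%R = c * Ka * (rtr (rho a))%:E.
  rewrite -muleA; congr (_ * _).
  rewrite KE {1}/rtr mxtrace_tr -/(rtr (rho a)).
  (* If the trace vanishes, both sides are 0 whatever the value of Ka. *)
  have [t0|t0] := eqVneq (\tr (rho a)) 0%R.
    by rewrite /rtr t0 mul0e mule0.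
  by rewrite muleC /Ka K_normalized // mxtraceZ mxtrace_tr mulVf.
split.
- exact: K_rho_tilde_sum_le.
- rewrite K_tr //; apply: lee_wpmul2l; first by rewrite lee_fin.
  (* All terms other than that of a are nonnegative and are dropped. *)
  by rewrite (bigD1 a) //= leeDl //; apply: sume_ge0 => j _; exact: K_ge0.
- exact: etrans cK (congr1 (fun x : R => c * Ka * x%:E) (esym e01)).
- exact: (congr1 (fun x : R => c * Ka * x%:E) (etrans e01 (esym epm))).
Qed.
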